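(* Assume $\alpha\in(0,2)$ and $d\ge2$. Then the moving average operator scaling stable random field $Z_\alpha$ is almost surely unbounded on every open ball of $\mathbb{R}^d$.
   Context: Let $E$ be a real $d\times d$ matrix all of whose complex eigenvalues have real part $>1$. Put $q=\mathrm{trace}(E)$ and $c^E=\exp(E\log c)$ for $c>0$. $\|\cdot\|$ denotes the Euclidean norm. Polar coordinates: fix a norm $\|\cdot\|_E$ on $\mathbb{R}^d$ such that, with $S_E=\{x:\|x\|_E=1\}$, the map $(0,\infty)\times S_E\to\mathbb{R}^d\setminus\{0\}$, $(r,\theta)\mapsto r^E\theta$, is a homeomorphism (such a norm exists). For $x\ne0$, $\tau_E(x)>0$ is the unique $r>0$ such that $x=r^E\theta$ with $\theta\in S_E$; $\tau_E(0)=0$. The field: let $\varphi:\mathbb{R}^d\to[0,\infty)$ be continuous and $E$-homogeneous, i.e. $\varphi(c^Ex)=c\,\varphi(x)$ for all $c>0$, $x\in\mathbb{R}^d$. Assume that for some $\beta>1$ the function $\varphi$ is $(\beta,E)$-admissible, i.e. $\varphi(x)\ne0$ for $x\neq0$ and for any $0<A<B$ there is a constant $C>0$ such that, for $A\le\|y\|\le B$, the inequality $|\varphi(x+y)-\varphi(y)|\le C\,\tau_E(x)^\beta$ holds for every $x$ with $\tau_E(x)\le1$. Let $M_\alpha(dy)$ be an independently scattered symmetric $\alpha$-stable random measure on $\mathbb{R}^d$ with Lebesgue control measure. Then $$Z_\alpha(x)=\int_{\mathbb{R}^d}\big(\varphi(x-y)^{1-q/\alpha}-\varphi(-y)^{1-q/\alpha}\big)\,M_\alpha(dy),\quad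 x\in\mathbb{R}^d,$$ which is well defined. *)

(* Defs.v *)
From HB Require Import structures.
From mathcomp Require Import all_boot all_order all_algebra.
From mathcomp Require Import all_classical all_reals all_analysis.
From mathcomp Require Import measurable_realfun complex.

Set Implicit Arguments.
Unset Strict Implicit.
Unset Printing Implicit Defensive.

Import Order.TTheory GRing.Theory Num.Theory.
Import numFieldNormedType.Exports HBSimple.

Local Open Scope classical_set_scope.
Local Open Scope ring_scope.

Definition borel_cV (R : realType) (d : nat) :=
  g_sigma_algebraType (@open 'cV[R]_d).

(* Iterated integration, one coordinate at a time; [lebesgue_cV_box] below
   gives the value on boxes, which determines the measure. *)
Fixpoint lebesgue_cV (R : realType) (d : nat) : set (borel_cV R d) -> \bar R :=
  match d with
  | 0 => fun A => dirac (0 : borel_cV R 0) A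
  | d'.+1 => fun A =>
      (\int[@lebesgue_measure R]_t
        lebesgue_cV [set v : borel_cV R d' | A (col_mx (t%:M : 'cV_1) v)])%E
  end.
Arguments lebesgue_cV : clear implicits.

Section lebesgue_cV_measure.
Variable R : realType.

Lemma open_cV_measurable d (A : set 'cV[R]_d) :
  open A -> measurable (A : set (borel_cV R d)).
Proof. by move=> oA; exact: sub_sigma_algebra. Qed.

Lemma coord_cV_measurable d (i : 'I_d) :
  measurable_fun setT (fun v : borel_cV R d => (v : 'cV[R]_d) i 0).
Proof.
apply: (measurability (@RGenOpens.G R)).
  exact: RGenOpens.measurableE.
move=> _ [B [a [b ->]] <-]; rewrite setTI.
apply: open_cV_measurable; apply: open_comp; last exact: interval_open.
by move=> v _; exact: coord_continuous.
Qed.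

Lemma open_cV_rat_balls d (A : set 'cV[R]_d) : open A ->
  A = \bigcup_(p in [set p : 'cV[rat]_d * nat |
         ball (map_mx ratr p.1 : 'cV[R]_d) p.2.+1%:R^-1 `<=` A])
        ball (map_mx ratr p.1 : 'cV[R]_d) p.2.+1%:R^-1.
Proof.
move=> oA; apply/seteqP; split => [x Ax|x [p /= + xp]]; last exact.
have /nbhs_ballP[e /= e0 eA] : nbhs x A by exact: open_nbhs_nbhs.
have [k ke] : exists k, k.+1%:R^-1 < e / 2.
  have /ltr_add_invr[k] : 0 < e / 2 by rewrite divr_gt0.
  by rewrite add0r; exists k.
have kp : 0 < k.+1%:R^-1 :> R by rewrite invr_gt0.
have /choice[q qP] (i : 'I_d) : exists q : rat, ball (x i 0) k.+1%:R^-1 (ratr q).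
  have ne : (ball (x i 0 : R) k.+1%:R^-1) !=set0 by exists (x i 0); exact: ballxx.
  have [y [Bi [q _ qy]]] := dense_rat ne (ball_open (x i 0 : R^o) k.+1%:R^-1).
  by exists q; rewrite qy.
have xq : ball x k.+1%:R^-1 (map_mx ratr (\col_i q i) : 'cV[R]_d).
  split => // i j; rewrite !mxE (ord1 j); exact: qP.
exists (\col_i q i, k) => /=; last exact: ball_sym.
move=> y qy; apply: eA; rewrite (splitr e).
apply: ball_triangle; first exact: (le_ball (ltW ke) xq).
exact: (le_ball (ltW ke) qy).
Qed.

Lemma measurable_fun_cV dT (T : measurableType dT) d (f : T -> borel_cV R d) :
  (forall i, measurable_fun setT (fun t => (f t : 'cV[R]_d) i 0)) ->
  measurable_fun setT f.
Proof.
move=> mf; apply: (measurability (@open 'cV[R]_d : set (set (borel_cV R d)))) => //.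
move=> _ [B oB <-]; rewrite setTI (open_cV_rat_balls oB) preimage_bigcup.
rewrite bigcup_mkcond; apply: countable_bigcupT_measurable => [|p]; first exact: countableP.
case: ifPn => // _; case: p => q k.
rewrite (_ : _ @^-1` _ = \bigcap_(i in [set: 'I_d])
  (fun t => (f t : 'cV[R]_d) i 0) @^-1`
     ball (ratr (q i 0) : R) k.+1%:R^-1).
  apply: fin_bigcap_measurable; first exact: finite_finset.
  move=> i _; rewrite -[X in measurable X]setTI; apply: mf => //.
  exact: measurable_ball.
apply/seteqP; split => [t [_ H] i _|t H].
  by have := H i 0; rewrite mxE.
by split=> [|i j]; rewrite ?invr_gt0 // mxE (ord1 j); exact: H.
Qed.

Lemma col_mx_cV_measurable d :
  measurable_fun setT (fun p : R * borel_cV R d =>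
    (col_mx (p.1%:M : 'cV_1) p.2 : 'cV[R]_(d.+1)) : borel_cV R d.+1).
Proof.
apply: measurable_fun_cV => i.
have [j ij|j ij] := @split_ordP 1 d i.
  rewrite (_ : (fun _ => _) = fst) //.
  apply/funext => p /=; rewrite ij.
  by apply: etrans (col_mxEu (p.1%:M : 'cV_1) p.2 j 0) _; rewrite (ord1 j) mxE.
rewrite (_ : (fun _ => _) = (fun v : borel_cV R d => (v : 'cV[R]_d) j 0) \o snd).
  by apply: measurableT_comp => //; exact: coord_cV_measurable.
by apply/funext => p /=; rewrite ij; exact: (col_mxEd (p.1%:M : 'cV_1) p.2).
Qed.

Lemma product_sigma_finite d1 d2 (T1 : measurableType d1)
    (T2 : measurableType d2) (m1 : {sigma_finite_measure set T1 -> \bar R})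
    (m2 : {sigma_finite_measure set T2 -> \bar R}) :
  sigma_finite setT (m1 \x m2)%E.
Proof.
have /sigma_finiteP[F [TF ndF Foo]] := sigma_finiteT m1.
have /sigma_finiteP[G [TG ndG Goo]] := sigma_finiteT m2.
exists (fun n => F n `*` G n).
  rewrite -setXTT TF TG predeqE => -[x y]; split.
    move=> [/= [n _ Fnx] [k _ Gky]]; exists (maxn n k) => //; split.
    - by move: x Fnx; exact/subsetPset/ndF/leq_maxl.
    - by move: y Gky; exact/subsetPset/ndG/leq_maxr.
  by move=> [n _ []/= ? ?]; split; exists n.
move=> k; have [? ?] := Foo k; have [? ?] := Goo k.
split; first exact: measurableX.
by rewrite product_measure1E// lte_mul_pinfty// ge0_fin_numE.
Qed.

Lemma pushforward_sigma_finite_measure d1 d2 (T1 : measurableType d1)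
    (T2 : measurableType d2) (m : {measure set T1 -> \bar R})
    (f : T1 -> T2) (g : T2 -> T1) :
  sigma_finite setT m ->
  measurable_fun setT f -> measurable_fun setT g -> cancel f g ->
  exists n : {sigma_finite_measure set T2 -> \bar R},
    forall A, n A = pushforward m f A.
Proof.
move=> [F FT mF] mf mg fK.
pose n : set T2 -> \bar R := pushforward m f.
have n0 : n set0 = 0%E by rewrite /n /pushforward preimage_set0 measure0.
have n_ge0 A : (0 <= n A)%E by exact: measure_ge0.
have n_sa : semi_sigma_additive n.
  move=> G mG tG mUG; rewrite /n /pushforward preimage_bigcup.
  apply: measure_semi_sigma_additive.
  - by move=> k; rewrite -[X in measurable X]setTI; exact: mf.
  - apply/trivIsetP => /= i j _ _ ij; rewrite -preimage_setI.
    by move/trivIsetP : tG => /(_ _ _ _ _ ij) ->//; rewrite preimage_set0.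
  - by rewrite -preimage_bigcup -[X in measurable X]setTI; exact: mf.
have n_sf : sigma_finite setT n.
  exists (fun k => g @^-1` F k); first by rewrite -preimage_bigcup -FT.
  move=> k; have [mFk Fk] := mF k; split.
    by rewrite -[X in measurable X]setTI; exact: mg.
  by rewrite /n /pushforward -comp_preimage (_ : g \o f = id) //; exact/funext.
pose nM := isMeasure.Build _ _ _ n n0 n_ge0 n_sa.
pose nm : {measure set T2 -> \bar R} := HB.pack n nM.
pose nS := @Measure_isSigmaFinite.Build _ _ _ nm n_sf.
pose ns : {sigma_finite_measure set T2 -> \bar R} := HB.pack n nM nS.
by exists ns.
Qed.

Lemma lebesgue_cV_sigma_finite_measure d :
  exists m : {sigma_finite_measure set (borel_cV R d) -> \bar R},
    forall A, lebesgue_cV R d A = m A.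
Proof.
elim: d => [|d [m mE]]; first by exists (dirac (0 : borel_cV R 0)).
pose f (p : R * borel_cV R d) : borel_cV R d.+1 :=
  (col_mx (p.1%:M : 'cV_1) p.2 : 'cV[R]_(d.+1)).
pose mf : measurable_fun setT f := @col_mx_cV_measurable d.

have lE A : lebesgue_cV R d.+1 A = pushforward (lebesgue_measure \x m)%E f A.
  rewrite /pushforward /product_measure1 /=; apply: eq_integral => t _ /=.
  rewrite mE; congr (m _); apply/seteqP; split => v; rewrite /xsection /= inE //.
pose g (v : borel_cV R d.+1) : R * borel_cV R d :=
  ((v : 'cV[R]_d.+1) 0 0, dsubmx (v : 'cV[R]_(1 + d))).
have mg : measurable_fun setT g.
  apply/measurable_fun_pairP; split; first exact: coord_cV_measurable.
  apply: measurable_fun_cV => i /=.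
  rewrite (_ : (fun _ => _) =
      fun v : borel_cV R d.+1 => (v : 'cV[R]_d.+1) (rshift 1 i) 0).
    exact: coord_cV_measurable.
  by apply/funext => v; rewrite mxE.
have fK p : g (f p) = p.
  case: p => t v; congr pair; last exact: (col_mxKd (t%:M : 'cV_1)).
  have -> : (0 : 'I_d.+1) = lshift d (0 : 'I_1) by apply: val_inj.
  by apply: etrans (col_mxEu (t%:M : 'cV_1) v 0 0) _; rewrite mxE.
have [n nE] := @pushforward_sigma_finite_measure _ _
  (measurableTypeR R * borel_cV R d)%type _ (@lebesgue_measure R \x m)%E
  f g (product_sigma_finite _ _) (@col_mx_cV_measurable d) mg fK.
by exists n => A; rewrite lE nE.
Qed.

Let lebesgue_cV0 d : lebesgue_cV R d set0 = 0%E.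
Proof. by have [m mE] := lebesgue_cV_sigma_finite_measure d; rewrite mE. Qed.

Let lebesgue_cV_ge0 d A : (0 <= lebesgue_cV R d A)%E.
Proof. by have [m mE] := lebesgue_cV_sigma_finite_measure d; rewrite mE. Qed.

Let lebesgue_cV_sigma_additive d : semi_sigma_additive (lebesgue_cV R d).
Proof.
have [m mE] := lebesgue_cV_sigma_finite_measure d.
have -> : lebesgue_cV R d = m by apply: funext => A; exact: mE.
exact: measure_semi_sigma_additive.
Qed.

HB.instance Definition _ d := isMeasure.Build _ _ _ (lebesgue_cV R d)
  (lebesgue_cV0 d) (@lebesgue_cV_ge0 d) (@lebesgue_cV_sigma_additive d).

Let lebesgue_cV_sigma_finite d : sigma_finite setT (lebesgue_cV R d).
Proof.
have [m mE] := lebesgue_cV_sigma_finite_measure d.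
have -> : lebesgue_cV R d = m by apply: funext => A; exact: mE.
exact: sigma_finiteT.
Qed.

HB.instance Definition _ d := Measure_isSigmaFinite.Build _ _ _
  (lebesgue_cV R d) (lebesgue_cV_sigma_finite d).

Lemma lebesgue_cV_box d (a b : 'cV[R]_d) : (forall i, a i 0 <= b i 0) ->
  lebesgue_cV R d [set x | forall i, a i 0 < (x : 'cV[R]_d) i 0 <= b i 0] =
  (\prod_(i < d) (b i 0 - a i 0))%:E.
Proof.
elim: d => [|d IHd] in a b *.
  by move=> _; rewrite big_ord0 /= diracE mem_set // => -[].
move=> ab /=.
pose a' := dsubmx (a : 'cV[R]_(1 + d)); pose b' := dsubmx (b : 'cV[R]_(1 + d)).
have sE (j : 'I_d) : rshift 1 j = lift 0 j :> 'I_d.+1 by exact: val_inj.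
have ab' i : a' i 0 <= b' i 0 by rewrite !mxE.
pose I0 : set R := `]a 0 0, b 0 0]%classic.
transitivity (\int[@lebesgue_measure R]_t
    ((\prod_(i < d) (b' i 0 - a' i 0))%:E * (\1_I0 t)%:E))%E; last first.
  rewrite ge0_integralZl_EFin //; last 2 first.
  - apply/measurable_EFinP; apply: measurable_indic; exact: measurable_itv.
  - by apply: prodr_ge0 => i _; rewrite subr_ge0.
  have mI0 : measurable I0 by exact: measurable_itv.
  have I0E := integral_indic (@lebesgue_measure R) measurableT mI0.
  have I0l : lebesgue_measure I0 = _ := lebesgue_measure_itv `]a 0 0, b 0 0].
  rewrite [X in (_ * X)%E](etrans I0E (etrans (congr1 _ (setIT I0)) I0l)) /=.
  rewrite lte_fin.
  rewrite big_ord_recl mulrC EFinM.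
  congr (_ * _)%E.
    by congr (_%:E); apply: eq_bigr => i _; rewrite !mxE sE.
  case: ltP => // ba; rewrite (_ : b 0 0 = a 0 0) ?subrr //.
  by apply/eqP; rewrite eq_le ba ab.
apply: eq_integral => t _.
have cE0 v : (col_mx (t%:M : 'cV_1) v : 'cV[R]_d.+1) 0 0 = t.
  have -> : (0 : 'I_d.+1) = lshift d (0 : 'I_1) by apply: val_inj.
  by apply: etrans (col_mxEu (t%:M : 'cV_1) v 0 0) _; rewrite mxE.
have cEs v j : (col_mx (t%:M : 'cV_1) v : 'cV[R]_d.+1) (lift 0 j) 0 = v j 0.
  by rewrite -sE; exact: (col_mxEd (t%:M : 'cV_1) v).
rewrite indicE; have [tab|tab] := boolP (t \in I0).
  rewrite mule1 -(IHd _ _ ab'); congr (lebesgue_cV R d _).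
  apply/seteqP; split=> v /= H i.
    by have := H (lift 0 i); rewrite cEs !mxE sE.
  case: (unliftP 0 i) => [j ->|->]; first by have := H j; rewrite cEs !mxE sE.
  by rewrite cE0; move: tab; rewrite /I0 inE /= in_itv.
rewrite mule0 -[RHS](measure0 (lebesgue_cV R d)); congr (lebesgue_cV R d _).
apply/seteqP; split=> v //= /(_ 0); rewrite cE0 => H.
by move: tab; rewrite /I0 notin_setE /= in_itv /= H.
Qed.

End lebesgue_cV_measure.

Section linear_algebra.
Variables (R : realType) (d : nat).
Implicit Types (E : 'M[R]_d) (x : 'cV[R]_d) (N phi : 'cV[R]_d -> R).

Definition enorm x : R := Num.sqrt (\sum_(i < d) x i 0 ^+ 2).

Definition eball (c : 'cV[R]_d) (r : R) : set 'cV[R]_d :=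
  [set x | enorm (x - c) < r].

Definition is_norm N :=
  [/\ forall x, N x = 0 -> x = 0,
      forall x y, N (x + y) <= N x + N y &
      forall (a : R) x, N (a *: x) = `|a| * N x].

Definition mexp E : 'M[R]_d :=
  limn (series (fun k => (k`!%:R)^-1 *: E ^+ k)).

Definition mpow (c : R) E : 'M[R]_d := mexp (ln c *: E).

Definition polar_map E (p : R * 'cV[R]_d) : 'cV[R]_d := mpow p.1 E *m p.2.

(* The radial part of x <> 0 in the coordinates [polar_map E] over the unit
   sphere of N, and 0 at the origin. *)
Definition polar_radius E N x : R :=
  if x == 0 then 0
  else xget 0 [set r | 0 < r /\
                 exists2 theta, N theta = 1 & x = polar_map E (r, theta)].

Definition operator_homogeneous E phi :=
  forall (c : R) x, 0 < c -> phi (mpow c E *m x) = c * phi x.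

Definition admissible (beta : R) E N phi :=
  (forall x, x != 0 -> phi x != 0) /\
  forall A B : R, 0 < A -> A < B -> exists2 C : R, 0 < C &
    forall y, A <= enorm y <= B ->
    forall x, polar_radius E N x <= 1 ->
      `|phi (x + y) - phi y| <= C * polar_radius E N x `^ beta.

(* [powR] sends 0 to 0 at a negative exponent; as a function of y this only
   concerns the two points y = x and y = 0. *)
Definition moving_average_kernel (alpha : R) E phi x (y : 'cV[R]_d) : R :=
  phi (x - y) `^ (1 - \tr E / alpha) - phi (- y) `^ (1 - \tr E / alpha).

End linear_algebra.

Definition homeomorphism_on (X Y : topologicalType) (A : set X) (B : set Y)
    (f : X -> Y) :=
  [/\ set_bij A B f, {within A, continuous f} &
      exists2 g : Y -> X, (forall x, A x -> g (f x) = x) &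
                          {within B, continuous g}].

Section probability_notions.
Context dO (Om : measurableType dO) (R : realType) (P : probability Om R).

Definition characteristic_function (X : Om -> R) (t : R) : R[i] :=
  Complex (\int[P]_w cos (t * X w)) (\int[P]_w sin (t * X w)).

Definition symmetric_stable (alpha sigma : R) (X : Om -> R) :=
  forall t, characteristic_function X t =
    real_complex R (expR (- (sigma `^ alpha * `|t| `^ alpha))).

Definition independent_variables n (X : 'I_n -> Om -> R) :=
  forall B : 'I_n -> set R, (forall i, measurable (B i)) ->
    P (\bigcap_i (X i @^-1` B i)) = (\prod_(i < n) P (X i @^-1` B i))%E.

Definition cvg_in_probability (X : nat -> Om -> R) (Y : Om -> R) :=
  forall e : R, 0 < e ->
    P [set w | e <= `|X n w - Y w|] @[n --> \oo] --> 0%E.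

End probability_notions.

Section stable_integral.
Context dO (Om : measurableType dO) (R : realType) (P : probability Om R).
Context dT (T : measurableType dT) (mu : {measure set T -> \bar R}).
Variable alpha : R.
Implicit Types (M : set T -> Om -> R) (f : T -> R).

(* A random measure is only meaningful on measurable sets of finite control
   measure; its values elsewhere are unconstrained. *)
Record stable_random_measure M : Prop := {
  srm_measurable : forall A, measurable A -> (mu A < +oo)%E ->
    measurable_fun setT (M A);
  srm_stable : forall A, measurable A -> (mu A < +oo)%E ->
    symmetric_stable P alpha (fine (mu A) `^ alpha^-1) (M A);
  srm_independent : forall n (A : 'I_n -> set T),
    (forall i, measurable (A i)) -> (forall i, (mu (A i) < +oo)%E) ->
    trivIset setT A -> independent_variables P (fun i => M (A i));
  srm_additive : forall A : nat -> set T,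
    (forall i, measurable (A i)) -> (mu (\bigcup_i A i) < +oo)%E ->
    trivIset setT A ->
    {ae P, forall w, series (fun i => M (A i) w) @ \oo --> M (\bigcup_i A i) w}
}.

(* For f in L^alpha the level sets at y <> 0 have finite measure, and the term
   y = 0 vanishes. *)
Definition stable_sintegral M f (w : Om) : R :=
  \sum_(y \in range f) y * M (f @^-1` [set y]) w.

Definition Lpow f : \bar R := (\int[mu]_t (`|f t| `^ alpha)%:E)%E.

(* X is a version of the integral of f in L^alpha against M: the limit in
   probability of the integrals of simple functions converging to f in
   L^alpha. *)
Definition is_stable_integral M f (X : Om -> R) :=
  [/\ measurable_fun setT f, (Lpow f < +oo)%E, measurable_fun setT X &
      exists g : nat -> {sfun T >-> R},
        [/\ forall n, (Lpow (g n) < +oo)%E,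
            Lpow (fun t => g n t - f t) @[n --> \oo] --> 0%E &
            cvg_in_probability P (fun n => stable_sintegral M (g n)) X]].

End stable_integral.

(* Main.v *)
Require Import Defs.
From HB Require Import structures.
From mathcomp Require Import all_boot all_order all_algebra.
From mathcomp Require Import all_classical all_reals all_analysis.
From mathcomp Require Import complex measurable_realfun ring lra.

(**
The trace of E exceeds d >= 2 > alpha, so the exponent 1 - tr E / alpha is
negative and the kernel of Z x is arbitrarily large near y = x.  By Baire's
theorem every ball contains an open set V in which the points x whose kernel
has L^alpha norm at most n are dense, for some n.  Given L, one can thus
choose finitely many such points x_j and disjoint sets Q_j filling most of a
box D in V, such that the kernel of Z x_j is at least L on Q_j.  Split Z x_j as
A_j + R_j, the integrals over Q_j and over its complement: R_j is independent
of A_j, and tight uniformly in j.  Since alpha < 2, P(|A_j| > K') is at least of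
the order of the integral over Q_j of the |kernel|^alpha, so the expected number
of j with |A_j| > K' is of order at least L^alpha |D|.  The A_j being
independent, a second moment argument yields with probability close to 1 an
index j for which |A_j| is large and |R_j| is not.

All this is carried out on simple functions approximating the kernels, for which
A_j and R_j are finite linear combinations of values of M.
*)

Set Implicit Arguments.
Unset Strict Implicit.
Unset Printing Implicit Defensive.

Import Order.TTheory GRing.Theory Num.Theory.
Import numFieldNormedType.Exports HBSimple.

Local Open Scope classical_set_scope.
Local Open Scope ring_scope.

(** The order of the choices shapes the proof. The tightness level of the R_j, and with it the
    threshold K', depends only on n, on the bound K to be exceeded and on the allowed probability,
    so n has to be fixed before L. Baire's theorem makes this possible: it turns finiteness of each
    kernel norm into a single bound on a set dense in an open set, without any estimate of the norm
    as a function of x. Only then is L chosen, and with it how close x_j must be to the points of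
    Q_j. The R_j are in general dependent on one another and on the A_i with i different from j, so
    the events that A_j is large and R_j is not cannot be treated as independent. What is available
    is independence of A_i and A_j, and of A_j and R_j for the same j; the second moment argument is
    arranged to use nothing else. Working with finitely many x_j also yields a measurable event that
    contains the event that the field is bounded by K on the ball. *)

(** * Independence and characteristic functions *)

Section independence.
Context dO (Om : measurableType dO) (R : realType) (P : probability Om R).

Lemma measurable_preimage (X : Om -> R) (B : set R) :
  measurable_fun setT X -> measurable B -> measurable (X @^-1` B).
Proof. by move=> mX mB; rewrite -[X in measurable X]setTI; exact: mX. Qed.

Lemma mfun_of d (T : measurableType d) (X : Om -> T) :
  measurable_fun setT X -> exists X' : {mfun Om >-> T}, X = X'.
Proof. by move=> mX; exists (mfun_Sub (mem_set mX)). Qed.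

(** The image under (X, Y) of P restricted to G, and the joint law scaled by P G, are finite
    measures on the plane that agree on rectangles, hence everywhere. *)
Lemma pair_indep_event (X Y : Om -> R) (G : set Om) :
  measurable_fun setT X -> measurable_fun setT Y -> measurable G ->
  (forall A B, measurable A -> measurable B ->
    P (X @^-1` A `&` Y @^-1` B `&` G) = (P (X @^-1` A `&` Y @^-1` B) * P G)%E) ->
  forall C : set (R * R), measurable C ->
    P ((fun w => (X w, Y w)) @^-1` C `&` G) =
    (P ((fun w => (X w, Y w)) @^-1` C) * P G)%E.
Proof.
move=> mX mY mG XYG C mC.
have mXY : measurable_fun setT (fun w => (X w, Y w)).
  exact: measurable_fun_pair.
have [Z ZE] := mfun_of mXY.
have rG : 0 <= fine (P G) by rewrite fine_ge0.
pose m1 :=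
  measure_function_pushforward__canonical__measure_function_Measure
    (mrestr P mG) (measurable_funPT Z).
pose m2 : measure _ R :=
  mscale (NngNum rG) (distribution P Z).
pose D : set (set (R * R)) :=
  [set A `*` B | A in measurable & B in measurable].
have H : m1 C = m2 C.
  apply: (@measure_unique _ R _ D (fun=> setT)) => //.
  - by rewrite measurable_prod_measurableType.
  - move=> _ _ [A mA [B mB <-]] [A' mA' [B' mB' <-]].
    rewrite -setXI; exists (A `&` A'); first exact: measurableI.
    by exists (B `&` B') => //; exact: measurableI.
  - by move=> _; exists setT => //; exists setT => //; rewrite setXTT.
  - by rewrite bigcup_const.
  - move=> _ [A mA [B mB <-]].
    rewrite /m1 /m2 /= /mscale /= /pushforward /mrestr /distribution /pushforward -ZE.
    by rewrite XYG// fineK ?fin_num_measure// muleC.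
  - move=> _; rewrite /m1 /= /pushforward /mrestr.
    by rewrite preimage_setT setTI -ge0_fin_numE// fin_num_measure.
move: H; rewrite /m1 /m2 /= /mscale /= /pushforward /mrestr.
rewrite /distribution /pushforward -ZE => ->.
by rewrite fineK ?fin_num_measure// muleC.
Qed.

(** An arbitrary event G lets the induction run: the hypothesis for n terms is used both with the
    event that X n is in B2 and with its intersection with G, which is what [pair_indep_event]
    requires of the partial sum and X n. *)
Lemma sum_indep_event (X : nat -> Om -> R) n (G : set Om) :
  (forall i, measurable_fun setT (X i)) -> measurable G ->
  (forall B : nat -> set R, (forall i, measurable (B i)) ->
    P (\big[setI/setT]_(i < n) (X i @^-1` B i)) =
    (\prod_(i < n) P (X i @^-1` B i))%E) ->
  (forall B : nat -> set R, (forall i, measurable (B i)) ->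
    P (\big[setI/setT]_(i < n) (X i @^-1` B i) `&` G) =
    ((\prod_(i < n) P (X i @^-1` B i)) * P G)%E) ->
  forall B, measurable B ->
    P ((fun w => \sum_(i < n) X i w) @^-1` B `&` G) =
    (P ((fun w => (\sum_(i < n) X i w)%R) @^-1` B) * P G)%E.
Proof.
move=> mX; elim: n G => [|n IH] G mG H0 HG B mB.
  rewrite (_ : (fun _ => _) = cst 0); last by apply/funext => w; rewrite big_ord0.
  rewrite preimage_cst; case: ifPn => _; first by rewrite setTI probability_setT mul1e.
  by rewrite set0I measure0 mul0e.
pose S w := \sum_(i < n) X i w.
have mS : measurable_fun setT S by exact: measurable_sum.
have bigE (B1 : nat -> set R) (B2 : set R) :
    \big[setI/setT]_(i < n.+1) (X i @^-1` (if (i < n)%N then B1 i else B2)) =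
    \big[setI/setT]_(i < n) (X i @^-1` B1 i) `&` X n @^-1` B2.
  rewrite big_ord_recr /= ltnn; congr (_ `&` _).
  by apply: eq_bigr => i _; rewrite ltn_ord.
have prodE (B1 : nat -> set R) (B2 : set R) :
    (\prod_(i < n.+1) P (X i @^-1` (if (i < n)%N then B1 i else B2)) =
    (\prod_(i < n) P (X i @^-1` B1 i)) * P (X n @^-1` B2))%E.
  rewrite big_ord_recr /= ltnn; congr (_ * _)%E.
  by apply: eq_bigr => i _; rewrite ltn_ord.
have mB12 (B1 : nat -> set R) (B2 : set R) : (forall i, measurable (B1 i)) ->
    measurable B2 -> forall i, measurable (if (i < n)%N then B1 i else B2).
  by move=> m1 m2 i; case: ifP.
have H0' (B1 : nat -> set R) (B2 : set R) : (forall i, measurable (B1 i)) ->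
    measurable B2 -> P (\big[setI/setT]_(i < n) (X i @^-1` B1 i) `&` X n @^-1` B2) =
    (\prod_(i < n) P (X i @^-1` B1 i) * P (X n @^-1` B2))%E.
  by move=> mB1 mB2; rewrite -bigE -prodE;
    exact: (H0 (fun i => if (i < n)%N then B1 i else B2) (mB12 _ _ mB1 mB2)).
have HG' (B1 : nat -> set R) (B2 : set R) : (forall i, measurable (B1 i)) ->
    measurable B2 ->
    P (\big[setI/setT]_(i < n) (X i @^-1` B1 i) `&` X n @^-1` B2 `&` G) =
    (\prod_(i < n) P (X i @^-1` B1 i) * P (X n @^-1` B2) * P G)%E.
  by move=> mB1 mB2; rewrite -bigE -prodE;
    exact: (HG (fun i => if (i < n)%N then B1 i else B2) (mB12 _ _ mB1 mB2)).
have prod1 : (\prod_(i < n) P (X i @^-1` setT) = 1)%E.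
  by rewrite big1// => i _; rewrite preimage_setT probability_setT.
have big1T : \big[setI/setT]_(i < n) (X i @^-1` setT) = setT.
  by rewrite big1// => i _; rewrite preimage_setT.
have H0n (B1 : nat -> set R) : (forall i, measurable (B1 i)) ->
    P (\big[setI/setT]_(i < n) (X i @^-1` B1 i)) =
    (\prod_(i < n) P (X i @^-1` B1 i))%E.
  move=> mB1; have := H0' _ _ mB1 measurableT.
  by rewrite preimage_setT setIT probability_setT mule1.
have PnG B2 : measurable B2 -> P (X n @^-1` B2 `&` G) = (P (X n @^-1` B2) * P G)%E.
  move=> mB2; have := HG' (fun=> setT) _ (fun=> measurableT) mB2.
  by rewrite big1T setTI prod1 mul1e.
have SX A B2 : measurable A -> measurable B2 ->
    P (S @^-1` A `&` X n @^-1` B2) = (P (S @^-1` A) * P (X n @^-1` B2))%E.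
  move=> mA mB2; apply: IH => //; first exact: measurable_preimage.
  by move=> B1 mB1; exact: H0'.
have SXG A B2 : measurable A -> measurable B2 ->
    P (S @^-1` A `&` X n @^-1` B2 `&` G) =
    (P (S @^-1` A `&` X n @^-1` B2) * P G)%E.
  move=> mA mB2; rewrite SX// -muleA -PnG// -setIA; apply: IH => //.
    by apply: measurableI => //; exact: measurable_preimage.
  by move=> B1 mB1; rewrite setIA HG'// PnG// muleA.
pose C := (fun p : R * R => p.1 + p.2) @^-1` B.
have mC : measurable C.
  rewrite -[X in measurable X]setTI.
  suff : measurable_fun setT (fun p : R * R => p.1 + p.2) by exact.
  by apply: measurable_funD.
have := pair_indep_event mS (mX n) mG SXG mC.
by rewrite (_ : _ @^-1` C = (fun w => \sum_(i < n.+1) X i w) @^-1` B)//;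
  apply/seteqP; split => w /=; rewrite /C /= big_ord_recr.
Qed.

End independence.

Section characteristic.
Context dO (Om : measurableType dO) (R : realType) (P : probability Om R).

(** Indexing by [nat] rather than ['I_n] makes truncating and splitting a family plain index
    arithmetic. *)
Definition indep_seq (X : nat -> Om -> R) n :=
  forall B : nat -> set R, (forall i, measurable (B i)) ->
    P (\big[setI/setT]_(i < n) (X i @^-1` B i)) =
    (\prod_(i < n) P (X i @^-1` B i))%E.

Definition indep_pair (X Y : Om -> R) :=
  forall A B : set R, measurable A -> measurable B ->
    P (X @^-1` A `&` Y @^-1` B) = (P (X @^-1` A) * P (Y @^-1` B))%E.

Lemma indep_seq_le (X : nat -> Om -> R) m n :
  (m <= n)%N -> indep_seq X n -> indep_seq X m.
Proof.
move=> mn Xn B mB.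
have := Xn (fun i => if (i < m)%N then B i else setT) _.
rewrite -(subnKC mn) !big_split_ord /=.
rewrite [X in _ `&` X]big1; last first.
  by move=> i _; rewrite ltnNge leq_addr /= preimage_setT.
rewrite [X in (_ * X)%E]big1; last first.
  by move=> i _; rewrite ltnNge leq_addr /= preimage_setT probability_setT.
rewrite setIT mule1.
under eq_bigr do rewrite ltn_ord.
under [in RHS]eq_bigr do rewrite ltn_ord.
by apply => i; case: ifP.
Qed.

(** Two uses of [sum_indep_event]: first G is an event of the second sum, then an intersection of
    events of the first block. *)
Lemma indep_seq_sums (X : nat -> Om -> R) n m :
  (forall i, measurable_fun setT (X i)) -> indep_seq X (n + m) ->
  indep_pair (fun w => \sum_(i < n) X i w) (fun w => \sum_(i < m) X (n + i)%N w).
Proof.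
move=> mX Xnm A B mA mB.
have mS2 : measurable_fun setT (fun w => \sum_(i < m) X (n + i)%N w).
  by apply: measurable_sum.
have Xn := indep_seq_le (leq_addr m n) Xnm.
have cut (B1 B2 : nat -> set R) : (forall i, measurable (B1 i)) ->
    (forall i, measurable (B2 i)) ->
    P (\big[setI/setT]_(i < n) (X i @^-1` B1 i) `&`
       \big[setI/setT]_(i < m) (X (n + i)%N @^-1` B2 i)) =
    ((\prod_(i < n) P (X i @^-1` B1 i)) *
     (\prod_(i < m) P (X (n + i)%N @^-1` B2 i)))%E.
  move=> mB1 mB2.
  have := Xnm (fun i => if (i < n)%N then B1 i else B2 (i - n)%N) _.
  rewrite !big_split_ord /=.
  under eq_bigr do rewrite ltn_ord.
  under [X in _ `&` X]eq_bigr do rewrite ltnNge leq_addr /= addKn.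
  under [in RHS]eq_bigr do rewrite ltn_ord.
  under [X in (_ * X)%E]eq_bigr do rewrite ltnNge leq_addr /= addKn.
  by apply => i; case: ifP.
have X2 : indep_seq (fun i => X (n + i)%N) m.
  move=> B2 mB2; have := cut (fun=> setT) B2 (fun=> measurableT) mB2.
  rewrite big1 ?setTI; last by move=> i _; rewrite preimage_setT.
  by rewrite [X in (X * _)%E]big1 ?mul1e// => i _; rewrite preimage_setT probability_setT.
apply: sum_indep_event => //; first exact: measurable_preimage.
move=> B1 mB1; rewrite -Xn// setIC muleC.
apply: (@sum_indep_event _ _ _ P (fun i => X (n + i)%N)) => //.
  by apply: bigsetI_measurable => i _; exact: measurable_preimage.
by move=> B2 mB2; rewrite setIC cut// Xn// muleC.
Qed.

Lemma integrable_le1 d (T : measurableType d) (Q : probability T R) (f : T -> R) :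
  measurable_fun setT f -> (forall x, `|f x| <= 1) ->
  Q.-integrable setT (EFin \o f).
Proof.
move=> mf f1; apply: measurable_bounded_integrable => //.
  by rewrite -ge0_fin_numE// fin_num_measure.
exists 1; split => // M M1 x _; exact: (le_trans (f1 x) (ltW M1)).
Qed.

(** By independence the joint law is the product of the marginal laws, and Fubini factors the
    integral. *)
Lemma indep_pair_integralM (X Y : Om -> R) (f g : R -> R) :
  measurable_fun setT X -> measurable_fun setT Y -> indep_pair X Y ->
  measurable_fun setT f -> measurable_fun setT g ->
  (forall x, `|f x| <= 1) -> (forall x, `|g x| <= 1) ->
  \int[P]_w (f (X w) * g (Y w)) = (\int[P]_w f (X w)) * (\int[P]_w g (Y w)).
Proof.
move=> mX mY XY mf mg f1 g1.
have [Z ZE] := mfun_of (measurable_fun_pair mX mY).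
have [X' XE] := mfun_of mX; have [Y' YE] := mfun_of mY.
pose h (p : R * R) : R := f p.1 * g p.2.
have mh : measurable_fun setT h.
  by apply: measurable_funM; apply: measurableT_comp.
have h1 p : `|h p| <= 1 by rewrite normrM mulr_ile1.
have mfX : measurable_fun setT (fun w => f (X w)) by exact: measurableT_comp.
have mgY : measurable_fun setT (fun w => g (Y w)) by exact: measurableT_comp.
have ihZ : P.-integrable setT ((EFin \o h) \o Z).
  by apply: integrable_le1 => //; exact: measurableT_comp.
have lawE A : measurable A -> A `<=` setT ->
    distribution P Z A = (distribution P X' \x distribution P Y')%E A.
  move=> mA _; apply/esym; apply: product_measure_unique => // A1 A2 mA1 mA2.
  by rewrite /= /distribution /pushforward -ZE -XE -YE -XY.
have ifX : P.-integrable setT (EFin \o (fun w => f (X w))).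
  by apply: integrable_le1.
have igY : P.-integrable setT (EFin \o (fun w => g (Y w))).
  by apply: integrable_le1.
have iprod : (distribution P X' \x distribution P Y')%E.-integrable setT (EFin \o h).
  apply/integrableP; split; first exact/measurable_EFinP.
  rewrite -(eq_measure_integral _ lawE).
  by have /integrableP[] := @integrable_le1 _ _ (distribution P Z) _ mh h1.
suff : ((\int[P]_w (f (X w) * g (Y w)))%:E =
    (\int[P]_w f (X w))%:E * (\int[P]_w g (Y w))%:E)%E.
  by move=> /eqP; rewrite -EFinM eqe => /eqP.
have ifg : P.-integrable setT (EFin \o (fun w => f (X w) * g (Y w))).
  apply: integrable_le1 => [|w]; first exact: measurable_funM.
  exact: (h1 (X w, Y w)).
rewrite /Rintegral !fineK; try exact: integrable_fin_num.
transitivity (\int[distribution P Z]_p (h p)%:E)%E.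
  rewrite integral_distribution//; last exact/measurable_EFinP.
  by apply: eq_integral => w _ /=; rewrite -ZE.
rewrite (eq_measure_integral _ lawE) -integral12_prod_meas1//.
rewrite /fubini_F /=.
under eq_integral => x _.
  under eq_integral => y _ do rewrite /h /= EFinM.
  rewrite integralZl//; last by apply: integrable_le1.
  over.
rewrite -[X in (_ * X)%E](_ : (\int[distribution P Y']_y (g y)%:E)%E = _); last first.
  by rewrite integral_distribution// -?YE//; exact/measurable_EFinP.
rewrite -[X in (X * _)%E](_ : (\int[distribution P X']_y (f y)%:E)%E = _); last first.
  by rewrite integral_distribution// -?XE//; exact/measurable_EFinP.
have gfin : (\int[distribution P Y']_y (g y)%:E)%E \is a fin_num.
  by apply: integrable_fin_num => //; apply: integrable_le1.
rewrite -(fineK gfin) integralZr//; by apply: integrable_le1.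
Qed.

(** The parameter s is the alpha-th power of the usual scale, so that parameters add under
    independent sums. *)
Definition stable_law (alpha s : R) (X : Om -> R) := forall t,
  \int[P]_w cos (t * X w) = expR (- (s * `|t| `^ alpha)) /\
  \int[P]_w sin (t * X w) = 0.

Lemma measurable_cosZ d (T : measurableType d) t (X : T -> R) : measurable_fun setT X ->
  measurable_fun setT (fun w => cos (t * X w)).
Proof.
move=> mX; apply: measurableT_comp => //.
  by apply: continuous_measurable_fun; exact: continuous_cos.
exact: measurable_funM.
Qed.

Lemma measurable_sinZ d (T : measurableType d) t (X : T -> R) : measurable_fun setT X ->
  measurable_fun setT (fun w => sin (t * X w)).
Proof.
move=> mX; apply: measurableT_comp => //.
  by apply: continuous_measurable_fun; exact: continuous_sin.
exact: measurable_funM.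
Qed.

Lemma stable_lawD alpha s s' (X Y : Om -> R) :
  measurable_fun setT X -> measurable_fun setT Y -> indep_pair X Y ->
  stable_law alpha s X -> stable_law alpha s' Y ->
  stable_law alpha (s + s') (fun w => X w + Y w).
Proof.
move=> mX mY XY sX sY t.
have mc : measurable_fun setT (fun x : R => cos (t * x)).
  exact: measurable_cosZ.
have ms : measurable_fun setT (fun x : R => sin (t * x)).
  exact: measurable_sinZ.
have mcX := measurable_cosZ t mX; have msX := measurable_sinZ t mX.
have mcY := measurable_cosZ t mY; have msY := measurable_sinZ t mY.
have c1 (x : R) : `|cos x| <= 1 by rewrite ler_norml cos_geN1 cos_le1.
have s1 (x : R) : `|sin x| <= 1 by rewrite ler_norml sin_geN1 sin_le1.
have [cX sX0] := sX t; have [cY sY0] := sY t.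
have E1 := indep_pair_integralM mX mY XY mc mc (fun=> c1 _) (fun=> c1 _).
have E2 := indep_pair_integralM mX mY XY ms ms (fun=> s1 _) (fun=> s1 _).
have E3 := indep_pair_integralM mX mY XY ms mc (fun=> s1 _) (fun=> c1 _).
have E4 := indep_pair_integralM mX mY XY mc ms (fun=> c1 _) (fun=> s1 _).
have M1 (f g : R -> R) x y : (forall x, `|f x| <= 1) -> (forall x, `|g x| <= 1) ->
   `|f x * g y| <= 1 by move=> f1 g1; rewrite normrM mulr_ile1.
split.
  under eq_Rintegral do rewrite mulrDr cosD.
  rewrite RintegralB//;
    try (apply: integrable_le1 => [|w]; [exact: measurable_funM|exact: M1]).
  by rewrite E1 E2 cX cY sX0 mul0r subr0 -expRD -opprD mulrDl.
under eq_Rintegral do rewrite mulrDr sinD.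
rewrite RintegralD//;
    try (apply: integrable_le1 => [|w]; [exact: measurable_funM|exact: M1]).
by rewrite E3 E4 sX0 sY0 mulr0 mul0r addr0.
Qed.

Lemma stable_lawZ alpha s c (X : Om -> R) :
  stable_law alpha s X -> stable_law alpha (`|c| `^ alpha * s) (fun w => c * X w).
Proof.
move=> sX t; have [cX sX0] := sX (t * c); split.
  under eq_Rintegral do rewrite mulrA.
  by rewrite cX normrM powRM//; congr (expR (- _)); ring.
by under eq_Rintegral do rewrite mulrA.
Qed.

Lemma symmetric_stable_law alpha s (X : Om -> R) : 0 < alpha -> 0 <= s ->
  symmetric_stable P alpha (s `^ alpha^-1) X -> stable_law alpha s X.
Proof.
move=> a0 s0 sX t; have := sX t; rewrite /characteristic_function => -[-> ->].
by rewrite -powRrM mulVf ?gt_eqF// powRr1.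
Qed.

Lemma stable_law0 alpha : stable_law alpha 0 (fun=> 0 : R).
Proof.
move=> t; split.
  under eq_Rintegral do rewrite mulr0 cos0.
  rewrite Rintegral_cst// mul0r oppr0 expR0 mul1r.
  exact: (congr1 fine (probability_setT P)).
under eq_Rintegral do rewrite mulr0 sin0.
by rewrite Rintegral_cst// mul0r.
Qed.

Lemma stable_law_sum alpha (X : nat -> Om -> R) (s : nat -> R) n :
  (forall i, measurable_fun setT (X i)) -> indep_seq X n ->
  (forall i, (i < n)%N -> stable_law alpha (s i) (X i)) ->
  stable_law alpha (\sum_(i < n) s i) (fun w => \sum_(i < n) X i w).
Proof.
move=> mX; elim: n => [|n IH] Xn sX.
  rewrite big_ord0 (_ : (fun _ => _) = fun=> 0); first exact: stable_law0.
  by apply/funext => w; rewrite big_ord0.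
rewrite big_ord_recr /= (_ : (fun _ => _) = fun w => \sum_(i < n) X i w + X n w); last first.
  by apply/funext => w; rewrite big_ord_recr.
apply: stable_lawD => //.
- exact: measurable_sum.
- have : indep_seq X (n + 1) by rewrite addn1.
  move/(indep_seq_sums mX); congr indep_pair.
  by apply/funext => w; rewrite big_ord1 addn0.
- by apply: IH => [|i ni]; [exact: indep_seq_le Xn|exact/sX/ltnW].
- exact: sX.
Qed.

End characteristic.

(** * Tails of symmetric stable laws *)

Section trigonometric_bounds.
Variable R : realType.
Implicit Types x y : R.

Lemma cos_norm x : cos `|x| = cos x.
Proof. by case: (ger0P x) => // _; rewrite cosN. Qed.

Lemma sin_le_id x : 0 <= x -> sin x <= x.
Proof.
move=> x0; have cs : {within `[0, x], continuous (@sin R)}.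
  by apply: continuous_subspaceT; exact: continuous_sin.
have [c] := @MVT_segment R sin cos 0 x x0 (fun t _ => is_derive_sin t) cs.
by move=> _; rewrite sin0 !subr0 => ->; rewrite ler_piMl// cos_le1.
Qed.

Lemma oneBcos_le x : 1 - cos x <= x ^+ 2.
Proof.
rewrite -[cos x]cos_norm -[x ^+ 2]real_normK ?num_real//.
have := normr_ge0 x; move: `|x| => z; move: z => {}x x0.
have cc : {within `[0, x], continuous (@cos R)}.
  by apply: continuous_subspaceT; exact: continuous_cos.
have [c] := @MVT_segment R cos (fun x => - sin x) 0 x x0 (fun t _ => is_derive_cos t) cc.
rewrite in_itv /= => /andP[c0 cx]; rewrite cos0 subr0 => h.
rewrite -opprB h mulNr opprK expr2 ler_wpM2r//.
exact: le_trans (sin_le_id c0) cx.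
Qed.

(** Half-angle formula: 1 - cos x = 2 sin^2 (x / 2), and by the mean value theorem sin (x / 2) >=
    cos 1 * (x / 2) for x in [0, 1], cos being decreasing there. *)
Lemma oneBcos_ge x : `|x| <= 1 -> cos 1 ^+ 2 / 2 * x ^+ 2 <= 1 - cos x.
Proof.
rewrite -[cos x]cos_norm -[x ^+ 2]real_normK ?num_real//.
have := normr_ge0 x; move: `|x| => z; move: z => {}x x0 x1.
have y0 : 0 <= x / 2 by rewrite divr_ge0.
have y1 : x / 2 <= 1 by lra.
rewrite {2}(splitr x) cosD -!expr2.
have pi1 : 1 <= pi :> R by have := pi_ge2 R; lra.
suff : cos 1 * (x / 2) <= sin (x / 2).
  move=> H; have c1 := cos1_gt0 R.
  have : (cos 1 * (x / 2)) ^+ 2 <= sin (x / 2) ^+ 2.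
    by rewrite ler_sqr ?nnegrE// ?(le_trans _ H)// mulr_ge0// ltW.
  by have := cos2Dsin2 (x / 2); rewrite exprMn; nra.
have cs : {within `[0, x / 2], continuous (@sin R)}.
  by apply: continuous_subspaceT; exact: continuous_sin.
have [c] := @MVT_segment R sin cos 0 (x / 2) y0 (fun t _ => is_derive_sin t) cs.
rewrite in_itv /= => /andP[c0 cx]; rewrite sin0 !subr0 => ->.
rewrite ler_wpM2r// leNgt; apply/negP => lt.
have := @ltr_cos R 1 c; rewrite !in_itv /= c0 ler01 pi1.
have c1 := le_trans cx y1.
rewrite (le_trans c1 pi1) => /(_ isT isT) /=; rewrite lt => /esym.
by rewrite ltNge c1.
Qed.

Lemma oneBexpRN_ge (v : R) : 0 <= v <= 1 -> v / 2 <= 1 - expR (- v).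
Proof.
move=> /andP[v0 v1]; rewrite expRN.
have e := expR_ge1Dx v.
have e0 : 0 < expR v by exact: expR_gt0.
have : (expR v)^-1 <= (1 + v)^-1 by rewrite lef_pV2 ?posrE//; lra.
have : (1 + v)^-1 <= 1 - v / 2.
  rewrite -[leLHS]mul1r ler_pdivrMr; last lra.
  nra.
lra.
Qed.

(** The integral equals u - sin (u x) / x, and 1 / |x| <= u / 2. This is what converts a
    characteristic function near 0 into a tail bound. *)
Lemma oneBcos_integral_ge (u x : R) : 0 < u -> 2 / u <= `|x| ->
  ((u / 2)%:E <= \int[lebesgue_measure]_(t in `[0%R, u]) (1 - cos (t * x))%:E)%E.
Proof.
move=> u0 ux.
have x0 : x != 0.
  by rewrite -normr_gt0 (lt_le_trans _ ux)// divr_gt0.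
pose F (t : R) : R := t - sin (t * x) / x.
have dF (t : R) : is_derive t (1 : R) F (1 - cos (t * x)).
  rewrite /F; apply: is_derive_eq.
  by rewrite /GRing.scale /=; field.
rewrite (@continuous_FTC2 R _ F)//.
- rewrite /F mul0r sin0 mul0r subr0 sube0 lee_fin.
  have : sin (u * x) / x <= u / 2.
    apply: (le_trans (ler_norm _)); rewrite normrM normfV.
    rewrite ler_pdivrMr ?normr_gt0// (le_trans (sin_max _))//.
    have : u / 2 * (2 / u) <= u / 2 * `|x| by rewrite ler_wpM2l// divr_ge0// ltW.
    by apply: le_trans; rewrite le_eqVlt; apply/orP; left; apply/eqP; field; lra.
  lra.
- apply: continuous_subspaceT => t.
  apply: cvgB; first exact: cvg_cst.
  have ct : {for t, continuous (fun t : R => t * x)}.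
    by apply: cvgM; [exact: cvg_id|exact: cvg_cst].
  exact: (continuous_comp ct (@continuous_cos R _)).
- have cF : continuous F.
    move=> t; apply: differentiable_continuous; apply/derivable1_diffP.
    exact: (@ex_derive _ _ _ _ _ _ _ (dF t)).
  split; first by move=> t _; exact: (@ex_derive _ _ _ _ _ _ _ (dF t)).
    exact/cvg_at_right_filter/cF.
  exact/cvg_at_left_filter/cF.
- by move=> t _; rewrite derive1E; exact: (@derive_val _ _ _ _ _ _ _ (dF t)).
Qed.

End trigonometric_bounds.

Section stable_tails.
Context dO (Om : measurableType dO) (R : realType) (P : probability Om R).
Variable alpha : R.
Hypothesis alpha_gt0 : 0 < alpha.

Lemma integrable_cosZ t (X : Om -> R) : measurable_fun setT X ->
  P.-integrable setT (EFin \o (fun w => cos (t * X w))).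
Proof.
by move=> mX; apply: integrable_le1 => [|w]; [exact: measurable_cosZ|exact: cos_max].
Qed.

Lemma integral_oneBcos s t (X : Om -> R) : 0 <= t -> measurable_fun setT X ->
  stable_law P alpha s X ->
  \int[P]_w (1 - cos (t * X w)) = 1 - expR (- (s * t `^ alpha)).
Proof.
move=> t0 mX sX; rewrite RintegralB//.
- rewrite Rintegral_cst// mul1r (congr1 fine (probability_setT P)).
  by have [-> _] := sX t; rewrite ger0_norm.
- by apply: integrable_le1 => // x; rewrite normr1.
- exact: integrable_cosZ.
Qed.

Lemma integrable_oneBcos t (X : Om -> R) : measurable_fun setT X ->
  P.-integrable setT (EFin \o (fun w => 1 - cos (t * X w))).
Proof.
move=> mX; have -> : EFin \o (fun w => 1 - cos (t * X w)) =
   ((EFin \o (cst 1%R)) \- (EFin \o (fun w => cos (t * X w))))%E.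
  by apply/funext => w /=; rewrite EFinB.
apply: integrableB => //; last exact: integrable_cosZ.
by apply: integrable_le1 => // x; rewrite normr1.
Qed.

Lemma Rintegral_indic (A : set Om) : measurable A -> \int[P]_w \1_A w = fine (P A).
Proof. by move=> mA; rewrite /Rintegral integral_indic// setIT. Qed.

Lemma integrable_indicT (A : set Om) : measurable A ->
  P.-integrable setT (EFin \o (\1_A : Om -> R)).
Proof.
move=> mA; apply: integrable_le1 => [|x]; first exact: measurable_indic.
by rewrite indicE; case: (_ \in _); rewrite ?normr1 ?normr0.
Qed.

Lemma measurable_norm_gt (X : Om -> R) c : measurable_fun setT X ->
  measurable [set w | c < `|X w|].
Proof.
move=> mX; rewrite -[X in measurable X]setTI.
have : measurable_fun setT (fun w => `|X w|) by exact: measurableT_comp.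
move=> /(_ measurableT `]c, +oo[%classic) /(_ (measurable_itv _)).
by congr measurable; apply/seteqP; split => w /=; rewrite in_itv /= andbT.
Qed.

Lemma measurable_norm_le (X : Om -> R) c : measurable_fun setT X ->
  measurable [set w | `|X w| <= c].
Proof.
move=> mX; rewrite (_ : [set w | _] = ~` [set w | c < `|X w|]).
  by apply: measurableC; exact: measurable_norm_gt.
by apply/seteqP; split => w /=; rewrite leNgt => /negP.
Qed.

(* For |X| <= K, 1 - cos (eta X / K) is O(eta^2 (1 - cos (X / K))), while the
   expectations of 1 - cos (eta X / K) and 1 - cos (X / K) are of order
   eta^alpha (s / K^alpha) and s / K^alpha; as alpha < 2, the former dominates
   for small eta, and the excess has to come from the event |X| > K. *)
Lemma stable_tail_lower : alpha < 2 -> exists2 c : R, 0 < c &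
  forall (X : Om -> R) s K, measurable_fun setT X -> 0 <= s -> 0 < K ->
    s <= K `^ alpha -> stable_law P alpha s X ->
    c * (s / K `^ alpha) <= fine (P [set w | K < `|X w|]).
Proof.
move=> alpha_lt2; pose k : R := cos 1 ^+ 2 / 2.
have c1 := cos1_gt0 R; have k0 : 0 < k by rewrite /k divr_gt0// exprn_gt0.
have kh : k <= 1 / 2 by rewrite /k; have := cos_le1 (1 : R); nra.
(* Chosen so that eta^2 / k = eta^alpha / 4. With u = s / K^alpha, the main term u eta^alpha / 2
   exceeds the subtracted one by u eta^alpha / 4; the factor 2 before the indicator turns this into
   the constant eta^alpha / 8. *)
pose eta : R := (k / 4) `^ (2 - alpha)^-1.
have eta0 : 0 < eta by rewrite powR_gt0//; lra.
have ea : 0 < eta `^ alpha by rewrite powR_gt0.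
have pow_le1 r x : 0 <= r -> 0 <= x -> x <= 1 -> x `^ r <= 1.
  by move=> r0 x0 x1; have := @ge0_ler_powR _ _ r0 x 1; rewrite !nnegrE powR1; apply.
have eta1 : eta <= 1 by apply: pow_le1; rewrite ?invr_ge0; lra.
have ea1 : eta `^ alpha <= 1 by apply: pow_le1 => //; exact: ltW.
have eta2 : eta ^+ 2 = k / 4 * eta `^ alpha.
  rewrite -powR_mulrn ?ltW// (_ : 2%:R = (2 - alpha) + alpha); last by lra.
  rewrite powRD; last by rewrite (gt_eqF eta0) implybT.
  by congr (_ * _); rewrite /eta -powRrM mulVf ?powRr1//; lra.
exists (eta `^ alpha / 8) => [|X s K mX s0 K0 sK sX]; first by rewrite divr_gt0.
have Ka : 0 < K `^ alpha by rewrite powR_gt0.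
pose A := [set w | K < `|X w|].
have mA : measurable A by exact: measurable_norm_gt.
(* On A the bound 2 is trivial; off A, y = X / K satisfies |y| <= 1, the range of [oneBcos_ge]. *)
have pt w : (1 - cos (eta / K * X w)) - eta ^+ 2 / k * (1 - cos (K^-1 * X w))
    <= 2 * \1_A w.
  rewrite indicE; have [/set_mem Aw|/negP nA] := boolP (w \in A).
    have := cos_geN1 (eta / K * X w); have := cos_le1 (K^-1 * X w).
    have : 0 <= eta ^+ 2 / k by rewrite divr_ge0 ?exprn_ge0// ltW.
    by move=> ? ? ?; rewrite mulr1; nra.
  have {}nA : `|K^-1 * X w| <= 1.
    rewrite normrM gtr0_norm ?invr_gt0// mulrC ler_pdivrMr// mul1r leNgt.
    by apply/negP => KX; apply: nA; rewrite inE.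
  rewrite mulr0 -mulrA; move: (K^-1 * X w) nA => y y1.
  have h1 := oneBcos_le (eta * y); have h2 := oneBcos_ge y1.
  rewrite subr_le0 (le_trans h1)// exprMn -mulrA ler_wpM2l ?exprn_ge0 ?(ltW eta0)//.
  by rewrite ler_pdivlMl.
have Kinv : K^-1 `^ alpha = (K `^ alpha)^-1.
  by rewrite -powRN -powR_inv1 ?ltW// -powRrM mulN1r.
have Ki0 : 0 <= K^-1 by rewrite invr_ge0 ltW.
have etaK0 : 0 <= eta / K by rewrite divr_ge0 ?ltW.
have etaK : (eta / K) `^ alpha = eta `^ alpha / K `^ alpha.
  by rewrite powRM ?Kinv// ltW.
pose u := s / K `^ alpha.
have u0 : 0 <= u by rewrite /u divr_ge0// ltW.
have u1 : u <= 1 by rewrite /u ler_pdivrMr// mul1r.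
have I1 : \int[P]_w (1 - cos (eta / K * X w)) = 1 - expR (- (u * eta `^ alpha)).
  rewrite (integral_oneBcos etaK0 mX sX) etaK.
  by congr (1 - expR (- _)); rewrite /u; ring.
have I2 : \int[P]_w (1 - cos (K^-1 * X w)) = 1 - expR (- u).
  by rewrite (integral_oneBcos Ki0 mX sX) Kinv.
have i1 := integrable_oneBcos (eta / K) mX; have i2 := integrable_oneBcos K^-1 mX.
have i2' : P.-integrable setT
    (EFin \o (fun w => eta ^+ 2 / k * (1 - cos (K^-1 * X w)))).
  by have := integrableZl measurableT (eta ^+ 2 / k) i2.
have i3 : P.-integrable setT (EFin \o (fun w => 2 * \1_A w)).
  by have := integrableZl measurableT 2 (integrable_indicT mA).
have := le_Rintegral measurableT _ i3 (fun w _ => pt w).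
rewrite RintegralB// RintegralZl// RintegralZl//; last exact: integrable_indicT.
rewrite I1 I2 Rintegral_indic//.
have iB := integrableB measurableT i1 i2'.
move=> /(_ iB).
(* The hypothesis s <= K^alpha enters here: u <= 1 keeps the exponent within the range of
   [oneBexpRN_ge]. *)
have h3 : u * eta `^ alpha / 2 <= 1 - expR (- (u * eta `^ alpha)).
  by apply: oneBexpRN_ge; nra.
have h4 : 1 - expR (- u) <= u by have := expR_ge1Dx (- u); lra.
have h5 : eta ^+ 2 / k * (1 - expR (- u)) <= eta `^ alpha / 4 * u.
  have -> : eta ^+ 2 / k = eta `^ alpha / 4 by rewrite eta2; field; lra.
  by rewrite ler_wpM2l// divr_ge0// ltW.
rewrite -/u; set p := fine _; move: (eta `^ alpha) (eta ^+ 2 / k) h3 h5 => a b h3 h5.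
lra.
Qed.


(** Integrate 1 - E cos (t X) <= s u^alpha over t in [0, u]. By Tonelli and [oneBcos_integral_ge]
    the left side becomes at least (u / 2) P(|X| > 2 / u). *)
Lemma stable_tail_upper (X : Om -> R) s u : measurable_fun setT X -> 0 <= s ->
  0 < u -> stable_law P alpha s X ->
  fine (P [set w | 2 / u < `|X w|]) <= 2 * (s * u `^ alpha).
Proof.
move=> mX s0 u0 sX; pose A := [set w | 2 / u < `|X w|].
have mA : measurable A by exact: measurable_norm_gt.
pose I : set R := `[0, u]%classic.
have mI : measurable I by exact: measurable_itv.
pose f (p : Om * R) : \bar R := ((1 - cos (p.2 * X p.1)) * \1_I p.2)%:E.
have oB0 x : 0 <= 1 - cos x :> R by rewrite subr_ge0 cos_le1.
have f0 p : (0 <= f p)%E by rewrite lee_fin mulr_ge0// indicE; case: (_ \in _).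
have mf : measurable_fun setT f.
  apply/measurable_EFinP; apply: measurable_funM; last first.
    by apply: measurableT_comp => //; exact: measurable_indic.
  apply: measurable_funB => //.
  apply: measurableT_comp; first by apply: continuous_measurable_fun; exact: continuous_cos.
  by apply: measurable_funM => //; exact: measurableT_comp.
have fub := @fubini_tonelli _ _ _ _ _ P (@lebesgue_measure R) f mf f0.
have lowE w : (((u / 2) * \1_A w)%:E <= \int[lebesgue_measure]_t f (w, t))%E.
  rewrite indicE; have [/set_mem Aw|_] := boolP (w \in A); last first.
    by rewrite mulr0; apply: integral_ge0 => t _; exact: f0.
  rewrite mulr1; apply: (le_trans (oneBcos_integral_ge u0 (ltW Aw))).
  rewrite integral_mkcond le_eqVlt; apply/orP; left; apply/eqP.
  apply: eq_integral => t _; rewrite /f /= patchE indicE.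
  by case: ifPn => _; rewrite ?mulr1 ?mulr0.
have upE t : (\int[P]_w f (w, t) <= (s * u `^ alpha * \1_I t)%:E)%E.
  rewrite /f /= indicE; have [/set_mem|_] := boolP (t \in I); last first.
    under eq_integral do rewrite mulr0.
    by rewrite integral0 mulr0.
  rewrite /I /= in_itv /= => /andP[t0 tu].
  under eq_integral do rewrite mulr1.
  have fi : (\int[P]_w (1 - cos (t * X w))%:E)%E \is a fin_num.
    by apply: integrable_fin_num => //; exact: integrable_oneBcos.
  rewrite -(fineK fi) lee_fin mulr1.
  have := integral_oneBcos t0 mX sX; rewrite /Rintegral => ->.
  have tua : t `^ alpha <= u `^ alpha.
    by apply: ge0_ler_powR; rewrite ?nnegrE// ltW.
  have : s * t `^ alpha <= s * u `^ alpha by rewrite ler_wpM2l.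
  have := expR_ge1Dx (- (s * t `^ alpha)); lra.
have lowI : ((u / 2)%:E * P A <= \int[P]_w \int[lebesgue_measure]_t f (w, t))%E.
  rewrite -(setIT A) -integral_indic// -ge0_integralZl//; last 2 first.
  - by apply/measurable_EFinP; exact: measurable_indic.
  - by rewrite lee_fin divr_ge0// ltW.
  apply: ge0_le_integral => //.
  - by move=> w _; rewrite -EFinM lee_fin mulr_ge0// divr_ge0// ltW.
  - apply/measurable_EFinP; apply: measurable_funM => //; exact: measurable_indic.
  - exact: measurable_fun_fubini_tonelli_F.
  - by move=> w _; rewrite -EFinM; exact: lowE.
have upI : (\int[lebesgue_measure]_t \int[P]_w f (w, t) <= (s * u `^ alpha * u)%:E)%E.
  apply: (@le_trans _ _ (\int[lebesgue_measure]_t (s * u `^ alpha * \1_I t)%:E)%E).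
    apply: ge0_le_integral => //.
    - by move=> t _; apply: integral_ge0 => w _; exact: f0.
    - exact: measurable_fun_fubini_tonelli_G.
    - apply/measurable_EFinP; apply: measurable_funM => //; exact: measurable_indic.
  under eq_integral do rewrite EFinM.
  rewrite ge0_integralZl//; last 2 first.
  - by apply/measurable_EFinP; exact: measurable_indic.
  - by rewrite lee_fin mulr_ge0// powR_ge0.
  have Il : lebesgue_measure I = _ := lebesgue_measure_itv `[0%R, u].
  have IE := integral_indic (@lebesgue_measure R) measurableT mI.
  rewrite [X in (_ * X <= _)%E](etrans IE (etrans (congr1 _ (setIT I)) Il)) /=.
  by rewrite lte_fin u0 oppr0 adde0 EFinM.
rewrite -fub in upI; have := le_trans lowI upI.
rewrite -/A.
have PA : P A = (fine (P A))%:E by rewrite fineK// fin_num_measure.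
rewrite PA -EFinM lee_fin => h.
have : u * fine (P A) <= u * (2 * (s * u `^ alpha)) by lra.
by rewrite ler_pM2l.
Qed.

End stable_tails.

(** * Integrals of simple functions *)

Section simple_integrals.
Context dO (Om : measurableType dO) (R : realType) (P : probability Om R).
Context dT (T : measurableType dT) (mu : {measure set T -> \bar R}).
Variables (alpha : R) (M : set T -> Om -> R).
Local Notation at0 := ((0%R : R), (set0 : set T)).
Hypothesis alpha_gt0 : 0 < alpha.
Hypothesis M_stable : stable_random_measure P mu alpha M.

Lemma indep_seq_atoms (c : nat -> R) (a : nat -> set T) n :
  (forall i, measurable (a i)) -> (forall i, (mu (a i) < +oo)%E) ->
  trivIset setT a -> indep_seq P (fun i w => c i * M (a i) w) n.
Proof.
move=> ma fa ta B mB.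
pose B' i := (fun x => c i * x) @^-1` B i.
have mB' i : measurable (B' i).
  rewrite -[X in measurable X]setTI.
  by have /(_ measurableT _ (mB i)) : measurable_fun setT (fun x => c i * x)
    by exact: measurable_funM.
have taI : trivIset setT (fun i : 'I_n => a i).
  move=> i j _ _ ij; apply: val_inj; exact: (ta (val i) (val j)).
have := @srm_independent _ _ _ _ _ _ _ _ _ M_stable n (fun i => a i) (fun i => ma i)
  (fun i => fa i) taI (fun i => B' i) (fun i => mB' i).
rewrite -(bigcap_mkord n (fun k => (fun w => c k * M (a k) w) @^-1` B k)).
rewrite (_ : \bigcap_i _ =
  \bigcap_(k in [set k | (k < n)%N]) ((fun w => c k * M (a k) w) @^-1` B k))//.
apply/seteqP; split => w /= H i.
  by move=> /= ni; exact: (H (Ordinal ni)).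
by move=> _; exact: (H _ (ltn_ord i)).
Qed.

Definition atoms_sum (s : seq (R * set T)) (w : Om) := \sum_(p <- s) p.1 * M p.2 w.

(** The index i is unrestricted: past the end [nth] returns the empty set, which is measurable, null
    and disjoint from everything, itself included. *)
Definition good_atoms (s : seq (R * set T)) :=
  (forall i, measurable (nth at0 s i).2 /\ (mu (nth at0 s i).2 < +oo)%E) /\
  trivIset setT (fun i => (nth at0 s i).2).

Lemma atoms_sumE s : atoms_sum s = fun w =>
  \sum_(i < size s) (nth at0 s i).1 * M (nth at0 s i).2 w.
Proof. by apply/funext => w; rewrite /atoms_sum (big_nth at0) big_mkord. Qed.

Lemma measurable_atom s i : good_atoms s -> measurable_fun setT
  (fun w => (nth at0 s i).1 * M (nth at0 s i).2 w).
Proof.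
move=> [gs _]; apply: measurable_funM => //.
by have [] := gs i; exact: (srm_measurable M_stable).
Qed.

Lemma measurable_atoms_sum s : good_atoms s -> measurable_fun setT (atoms_sum s).
Proof.
move=> gs; rewrite atoms_sumE; apply: measurable_sum => i; exact: measurable_atom.
Qed.

Lemma stable_law_atoms_sum s : good_atoms s ->
  stable_law P alpha (\sum_(p <- s) `|p.1| `^ alpha * fine (mu p.2)) (atoms_sum s).
Proof.
move=> gs; rewrite atoms_sumE (big_nth at0) big_mkord.
have [fs ts] := gs.
apply: (@stable_law_sum _ _ _ _ _
  (fun i w => (nth at0 s i).1 * M (nth at0 s i).2 w)
  (fun i => `|(nth at0 s i).1| `^ alpha * fine (mu (nth at0 s i).2))).
- by move=> i; exact: measurable_atom.
- by apply: indep_seq_atoms => // i; have [] := fs i.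
- move=> i _; apply: stable_lawZ; apply: symmetric_stable_law => //.
  by have [mi fi] := fs i; exact: (srm_stable M_stable).
Qed.

Lemma indep_atoms_sum s1 s2 : good_atoms (s1 ++ s2) ->
  indep_pair P (atoms_sum s1) (atoms_sum s2).
Proof.
move=> gs; have [fs ts] := gs.
have := @indep_seq_sums _ _ _ P
  (fun i w => (nth at0 (s1 ++ s2) i).1 * M (nth at0 (s1 ++ s2) i).2 w)
  (size s1) (size s2).
rewrite !atoms_sumE (_ : (fun w => \sum_(i < size s1) _) = fun w =>
  \sum_(i < size s1) (nth at0 s1 i).1 * M (nth at0 s1 i).2 w); last first.
  by apply/funext => w; apply: eq_bigr => i _; rewrite nth_cat ltn_ord.
rewrite (_ : (fun w => \sum_(i < size s2) _) = fun w =>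
  \sum_(i < size s2) (nth at0 s2 i).1 * M (nth at0 s2 i).2 w); last first.
  apply/funext => w; apply: eq_bigr => i _.
  by rewrite nth_cat ltnNge leq_addr /= addKn.
apply; first by move=> i; exact: measurable_atom.
by apply: indep_seq_atoms => // i; have [] := fs i.
Qed.

(** Countable additivity for A, B and then empty sets, once M vanishes almost surely on the empty
    set. *)
Lemma random_measureU A B : measurable A -> measurable B ->
  (mu A < +oo)%E -> (mu B < +oo)%E -> A `&` B = set0 ->
  {ae P, forall w, M (A `|` B) w = M A w + M B w}.
Proof.
move=> mA mB fA fB AB0.
have t0 : trivIset setT (fun _ : nat => set0 : set T).
  by apply/trivIsetP => i j _ _ _; rewrite set0I.
have f0 : (mu (\bigcup_(i : nat) (set0 : set T)) < +oo)%E.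
  by rewrite bigcup0// measure0.
have ae0 := srm_additive M_stable (fun _ : nat => measurable0) f0 t0.
pose F := bigcup2 A B.
have mF i : measurable (F i).
  by rewrite /F /bigcup2; case: ifP => // _; case: ifP.
have fF : (mu (\bigcup_i F i) < +oo)%E.
  rewrite bigcup2E measureU// lte_add_pinfty//.
have tF : trivIset setT F by rewrite /F -trivIset_bigcup2.
have aeF := srm_additive M_stable mF fF tF.
apply: filterS2 ae0 aeF => w /= w0 wF.
(* A convergent series with constant term has term 0. *)
have M0 : M set0 w = 0.
  have /cvg_series_cvg_0 : cvgn (series (fun=> M set0 w)) by apply/cvg_ex; eexists; exact: w0.
  by move/cvg_lim => <- //; rewrite lim_cst.
move: wF; rewrite bigcup2E => wF.
have : series (fun i => M (F i) w) @ \oo --> M A w + M B w.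
  rewrite -(cvg_shiftn 2) /=; apply: cvg_near_cst.
  near=> n; rewrite /series /= addn2 big_nat_recl// big_nat_recl// /F /bigcup2 /=.
  by rewrite big1 ?addr0//= => i _; rewrite M0.
by move/(cvg_unique _ wF) => ->.
Unshelve. all: by end_near. Qed.

(* The value 0 is left out, as its level set may have infinite measure. *)
Definition sfun_values (g : T -> R) : seq R :=
  [seq y <- finmap.enum_fset (fset_set (range g)) | y != 0].

(** With these atoms [atoms_sum] is the integral of g over Q, a finite combination of values of M on
    disjoint sets. *)
Definition sfun_atoms (g : T -> R) (Q : set T) :=
  [seq (y, g @^-1` [set y] `&` Q) | y <- sfun_values g].

Lemma sfun_values_uniq g : uniq (sfun_values g).
Proof. by rewrite filter_uniq// finmap.fset_uniq. Qed.

Lemma mem_sfun_values (g : {sfun T >-> R}) t : (g t \in sfun_values g) = (g t != 0).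
Proof.
rewrite mem_filter; case: (_ != 0) => //=.
by rewrite in_fset_set// mem_set//; exists t.
Qed.

Lemma stable_sintegralE (g : {sfun T >-> R}) :
  stable_sintegral M g = atoms_sum (sfun_atoms g setT).
Proof.
apply/funext => w; rewrite /stable_sintegral fsbig_finite//.
rewrite /atoms_sum /sfun_atoms big_map /sfun_values big_filter.
rewrite [LHS](bigID (fun y => y != 0)) /= [X in _ + X]big1 ?addr0; last first.
  by move=> i; rewrite negbK => /eqP ->; rewrite mul0r.
by apply: eq_bigr => y _; rewrite setIT.
Qed.

Lemma sfun_atom_fin (g : {sfun T >-> R}) y : (Lpow mu alpha g < +oo)%E ->
  y != 0 -> (mu (g @^-1` [set y]) < +oo)%E.
Proof.
move=> gfin y0.
have mg : measurable (g @^-1` [set y]) by exact: measurable_sfunP.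
have y1 : 0 < `|y| `^ alpha by rewrite powR_gt0// normr_gt0.
have : ((`|y| `^ alpha)%:E * mu (g @^-1` [set y]) <= Lpow mu alpha g)%E.
  have -> : mu (g @^-1` [set y]) = (\int[mu]_t (\1_(g @^-1` [set y]) t)%:E)%E.
    by rewrite integral_indic// setIT.
  rewrite -ge0_integralZl//; last by apply/measurable_EFinP; exact: measurable_indic.
  apply: ge0_le_integral => //.
  - by apply/measurable_EFinP; apply: measurable_funM => //; exact: measurable_indic.
  - apply/measurable_EFinP; apply: (measurableT_comp (measurable_powR _)) => //.
    exact: measurableT_comp.
  - move=> t _; rewrite -EFinM lee_fin indicE; have [/set_mem /= ->|_] := boolP (t \in _).
      by rewrite mulr1.
    by rewrite mulr0 powR_ge0.
move=> /le_lt_trans /(_ gfin).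
move: (measure_ge0 mu (g @^-1` [set y])); case: (mu _) => [r _ _|_|//].
  exact: ltry.
by rewrite gt0_muley// lte_fin.
Qed.

Lemma nth_sfun_atoms g Q i : (i < size (sfun_values g))%N ->
  nth at0 (sfun_atoms g Q) i =
  (nth 0 (sfun_values g) i, g @^-1` [set nth 0 (sfun_values g) i] `&` Q).
Proof. by move=> ig; rewrite (nth_map 0). Qed.

(** Level sets of g may meet those of h, so disjointness across the two lists comes from Q and Q'.
    Two functions are needed because different points of the field have different kernels. *)
Lemma good_sfun_atoms2 (g h : {sfun T >-> R}) (Q Q' : set T) :
  (Lpow mu alpha g < +oo)%E -> (Lpow mu alpha h < +oo)%E ->
  measurable Q -> measurable Q' -> Q `&` Q' = set0 ->
  good_atoms (sfun_atoms g Q ++ sfun_atoms h Q').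
Proof.
move=> gfin hfin mQ mQ' QQ'.
have fin1 (f : {sfun T >-> R}) D i : (Lpow mu alpha f < +oo)%E -> measurable D ->
    (i < size (sfun_values f))%N ->
    measurable (nth at0 (sfun_atoms f D) i).2 /\
    (mu (nth at0 (sfun_atoms f D) i).2 < +oo)%E.
  move=> ffin mD fi; rewrite nth_sfun_atoms//=.
  have mf : measurable (f @^-1` [set nth 0 (sfun_values f) i]) by exact: measurable_sfunP.
  split; first exact: measurableI.
  apply: (@le_lt_trans _ _ (mu (f @^-1` [set nth 0 (sfun_values f) i]))).
    by apply: le_measure; rewrite ?inE//; exact: measurableI.
  apply: sfun_atom_fin => //.
  by have := mem_nth 0 fi; rewrite mem_filter => /andP[].
split.
  move=> i; rewrite nth_cat size_map; case: ltnP => gi; first exact: fin1.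
  have [hi|hi] := ltnP (i - size (sfun_values g)) (size (sfun_values h)).
    exact: fin1.
  by rewrite nth_default ?size_map//= measure0.
have sub f D i t : (nth at0 (sfun_atoms f D) i).2 t ->
    [/\ (i < size (sfun_values f))%N, f t = nth 0 (sfun_values f) i & D t].
  have [fi|fi] := ltnP i (size (sfun_values f)).
    by rewrite nth_sfun_atoms//= => -[].
  by rewrite nth_default// size_map.
have inj f D i j t : (nth at0 (sfun_atoms f D) i).2 t ->
    (nth at0 (sfun_atoms f D) j).2 t -> i = j.
  move=> /sub[fi ft _] /sub[fj]; rewrite ft => /eqP.
  by rewrite nth_uniq ?sfun_values_uniq// => /eqP.
move=> i j _ _ [t [] /=]; rewrite !nth_cat size_map.
case: ltnP => gi; case: ltnP => gj.
- exact: inj.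
- by move=> /sub[_ _ Qt] /sub[_ _ Q't]; have : (Q `&` Q') t by []; rewrite QQ'.
- by move=> /sub[_ _ Q't] /sub[_ _ Qt]; have : (Q `&` Q') t by []; rewrite QQ'.
- move=> it jt; have := inj _ _ _ _ _ it jt => ij.
  by rewrite -(subnK gi) -(subnK gj) ij.
Qed.

Lemma good_sfun_atoms (g : {sfun T >-> R}) (Q : set T) :
  (Lpow mu alpha g < +oo)%E -> measurable Q -> good_atoms (sfun_atoms g Q).
Proof.
move=> gfin mQ.
have [h1 h2] := good_sfun_atoms2 gfin gfin mQ measurable0 (setI0 Q).
split => [i|i j _ _ [t [it jt]]].
  have [gi|gi] := ltnP i (size (sfun_atoms g Q)).
    by have := h1 i; rewrite nth_cat gi.
  by rewrite nth_default//= measure0.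
have sz k : (nth at0 (sfun_atoms g Q) k).2 t -> (k < size (sfun_atoms g Q))%N.
  by case: ltnP => // gk; rewrite nth_default.
by apply: h2 => //; exists t; rewrite /= !nth_cat !sz.
Qed.

(** Identifies the parameter found in [stable_law_atoms_sum]; the omitted value 0 contributes
    nothing since alpha > 0. *)
Lemma integral_sfun_atoms (g : {sfun T >-> R}) Q :
  (Lpow mu alpha g < +oo)%E -> measurable Q ->
  (\int[mu]_(t in Q) (`|g t| `^ alpha)%:E)%E =
  (\sum_(p <- sfun_atoms g Q) `|p.1| `^ alpha * fine (mu p.2))%:E.
Proof.
move=> gfin mQ; rewrite big_map /=.
have ma y : measurable (g @^-1` [set y]) by exact: measurable_sfunP.
transitivity (\int[mu]_(t in Q) (\sum_(y <- sfun_values g)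
    (`|y| `^ alpha * \1_(g @^-1` [set y]) t)%:E))%E.
  apply: eq_integral => t _; rewrite sumEFin; congr (_%:E).
  have [gt0|gt0] := eqVneq (g t) 0.
    rewrite gt0 normr0 powR0 ?gt_eqF// big_seq big1// => y.
    rewrite mem_filter => /andP[y0 _]; rewrite indicE memNset ?mulr0//=.
    by rewrite gt0 => /esym/eqP; rewrite (negbTE y0).
  rewrite (bigD1_seq (g t)) ?mem_sfun_values ?sfun_values_uniq//=.
  rewrite indicE mem_set//= mulr1 big1 ?addr0// => y yg.
  by rewrite indicE memNset ?mulr0//= => /eqP; rewrite eq_sym (negbTE yg).
rewrite ge0_integral_sum//; last first.
  by move=> y; apply/measurable_EFinP; apply: measurable_funM.
rewrite -sumEFin big_seq [RHS]big_seq; apply: eq_bigr => y.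
rewrite mem_filter => /andP[y0 _].
under eq_integral do rewrite EFinM.
rewrite ge0_integralZl//; last by apply/measurable_EFinP; exact: measurable_indic.
rewrite integral_indic// EFinM fineK// ge0_fin_numE//.
apply: (@le_lt_trans _ _ (mu (g @^-1` [set y]))); last exact: sfun_atom_fin.
by apply: le_measure; rewrite ?inE//; exact: measurableI.
Qed.

(** Holds only almost surely, as each of the finitely many level sets is split by
    [random_measureU]. *)
Lemma sfun_atoms_split (g : {sfun T >-> R}) Q :
  (Lpow mu alpha g < +oo)%E -> measurable Q ->
  {ae P, forall w, stable_sintegral M g w =
    atoms_sum (sfun_atoms g Q) w + atoms_sum (sfun_atoms g (~` Q)) w}.
Proof.
move=> gfin mQ; rewrite stable_sintegralE /atoms_sum /sfun_atoms.
have : {in sfun_values g, forall y, y != 0} by move=> y; rewrite mem_filter => /andP[].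
elim: (sfun_values g) => [|y v IH] v0.
  by apply: aeW => w; rewrite /= !big_nil addr0.
have v1 : {in v, forall z, z != 0}.
  by move=> z zv; apply: v0; rewrite in_cons zv orbT.
have {IH} := IH v1.
have y0 : y != 0 by apply: v0; rewrite mem_head.
have ma : measurable (g @^-1` [set y]) by exact: measurable_sfunP.
have fa := sfun_atom_fin gfin y0.
have mQy : measurable (g @^-1` [set y] `&` Q) by exact: measurableI.
have mQCy : measurable (g @^-1` [set y] `&` ~` Q).
  by apply: measurableI => //; exact: measurableC.
have f1 : (mu (g @^-1` [set y] `&` Q) < +oo)%E.
  by apply: le_lt_trans fa; apply: le_measure; rewrite ?inE.
have f2 : (mu (g @^-1` [set y] `&` ~` Q) < +oo)%E.
  by apply: le_lt_trans fa; apply: le_measure; rewrite ?inE.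
have d : (g @^-1` [set y] `&` Q) `&` (g @^-1` [set y] `&` ~` Q) = set0.
  by apply/seteqP; split => t //= [[_ ?] [_]].
have := random_measureU mQy mQCy f1 f2 d.
rewrite -setIUr setUv; apply: filterS2 => w /= e1 e2; rewrite !big_cons /= e1 e2; ring.
Qed.

End simple_integrals.

(** * Joint smallness of finitely many stable integrals *)

Section counting.
Context dO (Om : measurableType dO) (R : realType) (P : probability Om R).

Lemma sum_indic_integral (I : Type) (r : seq I) (A : I -> set Om) :
  (forall i, measurable (A i)) ->
  P.-integrable setT (EFin \o (fun w => \sum_(i <- r) (\1_(A i) w : R))) /\
  \int[P]_w (\sum_(i <- r) \1_(A i) w) = \sum_(i <- r) fine (P (A i)).
Proof.
move=> mA; elim: r => [|i r [ir Ir]].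
  have -> : (fun w : Om => \sum_(i <- [::]) (\1_(A i) w : R)) = cst 0.
    by apply/funext => w; rewrite big_nil.
  split; first by apply: integrable_le1 => // w; rewrite normr0.
  by rewrite big_nil Rintegral_cst// mul0r.
have -> : (fun w => \sum_(j <- i :: r) (\1_(A j) w : R)) =
    (fun w => \1_(A i) w + \sum_(j <- r) \1_(A j) w).
  by apply/funext => w; rewrite big_cons.
have ii := @integrable_indicT _ _ _ P _ (mA i).
split.
  have := integrableD measurableT ii ir.
  by congr (P.-integrable _ _); apply/funext => w /=; rewrite EFinD.
by rewrite RintegralD// Rintegral_indic// Ir big_cons.
Qed.

(* With N counting the events E i and N' those meeting F i, on the event in
   question N = N', so either N is far from its mean l or N' >= l / 2. *)
Lemma second_moment_bound n (E F : 'I_n -> set Om) (delta l : R) :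
  (forall i, measurable (E i)) -> (forall i, measurable (F i)) ->
  (forall i j, i != j -> P (E i `&` E j) = (P (E i) * P (E j))%E) ->
  (forall i, P (E i `&` F i) = (P (E i) * P (F i))%E) ->
  (forall i, fine (P (F i)) <= delta) ->
  l = \sum_(i < n) fine (P (E i)) -> 0 < l ->
  fine (P (\bigcap_i ~` (E i `\` F i))) <= 4 / l + 2 * delta.
Proof.
move=> mE mF EE EF Fd lE l0.
pose B := \bigcap_i ~` (E i `\` F i).
have mB : measurable B.
  apply: fin_bigcap_measurable => [|i _]; first exact: finite_finset.
  by apply: measurableC; exact: measurableD.
have mEF i : measurable (E i `&` F i) by exact: measurableI.
have mEE (p : 'I_n * 'I_n) : measurable (E p.1 `&` E p.2) by exact: measurableI.
pose N w : R := \sum_(i <- index_enum 'I_n) \1_(E i) w.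
pose N' w : R := \sum_(i <- index_enum 'I_n) \1_(E i `&` F i) w.
pose N2 w : R := \sum_(p <- index_enum ('I_n * 'I_n)%type) \1_(E p.1 `&` E p.2) w.
have [iN IN] := sum_indic_integral (index_enum 'I_n) mE.
have [iN' IN'] := sum_indic_integral (index_enum 'I_n) mEF.
have [iN2 IN2] := sum_indic_integral (index_enum ('I_n * 'I_n)%type) mEE.
have fM A A' : P A \is a fin_num -> P A' \is a fin_num ->
    fine (P A * P A')%E = fine (P A) * fine (P A') by move=> ? ?; rewrite fineM.
have p0 i : 0 <= fine (P (E i)) by rewrite fine_ge0.
have N2E w : N2 w = N w ^+ 2.
  rewrite /N2 /N expr2 big_distrlr /= pair_bigA /=.
  by apply: eq_bigr => p _; rewrite indicI.
(* The diagonal gives l, and by pairwise independence the remaining terms are at most l^2. *)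
have IN2le : \int[P]_w N2 w <= l + l ^+ 2.
  rewrite /N2 IN2 -(pair_bigA _ (fun i j => fine (P (E i `&` E j)))) /=.
  rewrite expr2 {2}lE mulr_suml -[X in X + _]/l {1}lE -big_split /=.
  apply: ler_sum => i _; rewrite (bigD1 i)//= setIid lerD2l.
  rewrite lE mulr_sumr [leRHS](bigD1 i)//= -[leLHS]add0r lerD ?mulr_ge0//.
  by apply: ler_sum => j ji; rewrite EE 1?eq_sym// fM ?fin_num_measure.
have IN'le : \int[P]_w N' w <= delta * l.
  rewrite /N' IN' lE mulr_sumr; apply: ler_sum => i _.
  by rewrite EF fM ?fin_num_measure// mulrC ler_wpM2r.
have N0 w : 0 <= N w by apply: sumr_ge0 => i _; rewrite indicE; case: (_ \in _).
have N'0 w : 0 <= N' w by apply: sumr_ge0 => i _; rewrite indicE; case: (_ \in _).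
(* That is, l^2 / 4 on B is at most (N - l)^2 + (l / 2) N'. Where N' = N, completing the square at N
   = 3 l / 4 leaves 3 l^2 / 16. The two terms on the right integrate to at most l and l^2 delta /
   2. *)
have pt w : l ^+ 2 / 4 * \1_B w + 2 * l * N w <= N2 w + (l ^+ 2 + l / 2 * N' w).
  rewrite N2E indicE; have [/set_mem Bw|_] := boolP (w \in B); last first.
    have : 0 <= l / 2 * N' w by rewrite mulr_ge0// divr_ge0// ltW.
    have := sqr_ge0 (N w - l); rewrite mulr0; nra.
  suff -> : N' w = N w.
    have := sqr_ge0 (N w - 3 / 4 * l); have := sqr_ge0 l; rewrite mulr1; nra.
  apply: eq_bigr => i _; rewrite !indicE; congr (nat_of_bool _)%:R.
  apply/idP/idP => /set_mem; first by move=> [Ei _]; exact: mem_set.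
  move=> Ei; apply: mem_set; split=> //.
  by apply: contrapT => nF; exact: (Bw i).
have i1 : P.-integrable setT (EFin \o (fun w => l ^+ 2 / 4 * \1_B w)).
  by have := integrableZl measurableT (l ^+ 2 / 4) (@integrable_indicT _ _ _ P _ mB).
have i2 : P.-integrable setT (EFin \o (fun w => 2 * l * N w)).
  by have := integrableZl measurableT (2 * l) iN.
have i3 : P.-integrable setT (EFin \o (fun w => l / 2 * N' w)).
  by have := integrableZl measurableT (l / 2) iN'.
have i4 : P.-integrable setT (EFin \o cst (l ^+ 2)).
  exact: (@finite_measure_integrable_cst _ _ _ P).
have i34 := integrableD measurableT i4 i3.
have i12 := integrableD measurableT i1 i2.
have i234 := integrableD measurableT iN2 i34.
have := le_Rintegral measurableT i12 i234 (fun w _ => pt w).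
rewrite RintegralD// RintegralZl//; last exact: integrable_indicT.
rewrite RintegralZl// RintegralD// RintegralD// RintegralZl// Rintegral_cst//.
rewrite (congr1 fine (probability_setT P)) mulr1.
rewrite Rintegral_indic// -/B.
have -> : \int[P]_w N w = l by rewrite /N IN lE.
move: (\int[P]_w N2 w) (\int[P]_w N' w) IN2le IN'le (fine (P B)) => a b ha hb p h.
have h1 : l ^+ 2 / 4 * p <= l + l / 2 * (delta * l).
  have : l / 2 * b <= l / 2 * (delta * l) by rewrite ler_wpM2l// divr_ge0// ltW.
  nra.
have l2 : 0 < l ^+ 2 / 4 by rewrite divr_gt0// exprn_gt0.
rewrite -(ler_pM2l l2) (le_trans h1)//.
rewrite le_eqVlt; apply/orP; left; apply/eqP; field; lra.
Qed.

End counting.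

Section small_probability.
Context dO (Om : measurableType dO) (R : realType) (P : probability Om R).
Context dT (T : measurableType dT) (mu : {measure set T -> \bar R}).
Variables (alpha : R) (M : set T -> Om -> R).
Hypothesis alpha_gt0 : 0 < alpha.
Hypothesis M_stable : stable_random_measure P mu alpha M.

Lemma indep_pair_norm_gt (X Y : Om -> R) a b : indep_pair P X Y ->
  P ([set w | a < `|X w|] `&` [set w | b < `|Y w|]) =
  (P [set w | (a < `|X w|)%R] * P [set w | (b < `|Y w|)%R])%E.
Proof.
move=> XY.
have m c : measurable [set x : R | c < `|x|] by exact: (@measurable_norm_gt _ R R id).
by have := XY _ _ (m a) (m b).
Qed.

(** If the sum of the two parts is at most K in absolute value, then either the part over Q i is at
    most K + 2 / u or the other part exceeds 2 / u. The condition on kappa puts every parameter in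
    the range of the lower tail bound, which is passed as a hypothesis so that c is fixed
    beforehand. *)
Lemma sfun_sums_bound n (c kappa u K S : R)
  (g : 'I_n -> {sfun T >-> R}) (Q : 'I_n -> set T) : 0 < c ->
  (forall (X : Om -> R) s K, measurable_fun setT X -> 0 <= s -> 0 < K ->
    s <= K `^ alpha -> stable_law P alpha s X ->
    c * (s / K `^ alpha) <= fine (P [set w | K < `|X w|])) ->
  0 < u -> 0 <= K -> 0 < S -> kappa <= (K + 2 / u) `^ alpha ->
  (forall i, measurable (Q i)) -> trivIset setT Q ->
  (forall i, (Lpow mu alpha (g i) <= kappa%:E)%E) ->
  S <= \sum_(i < n) fine (\int[mu]_(t in Q i) (`|g i t| `^ alpha)%:E)%E ->
  fine (P (\bigcap_(i : 'I_n) [set w |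
    `|atoms_sum M (sfun_atoms (g i) (Q i)) w +
      atoms_sum M (sfun_atoms (g i) (~` Q i)) w| <= K])) <=
  4 * (K + 2 / u) `^ alpha / (c * S) + 4 * (kappa * u `^ alpha).
Proof.
move=> c0 lower u0 K0 S0 kK mQ tQ gk Ss.
set K' := K + 2 / u.
have u20 : 0 < 2 / u by rewrite divr_gt0.
have K'0 : 0 < K' by rewrite /K'; lra.
have K'a : 0 < K' `^ alpha by rewrite powR_gt0.
have gfin i : (Lpow mu alpha (g i) < +oo)%E by exact: (le_lt_trans (gk i) (ltry _)).
have mg i : measurable_fun setT (fun t => (`|g i t| `^ alpha)%:E).
  apply/measurable_EFinP; apply: (measurableT_comp (measurable_powR _)) => //.
  exact: measurableT_comp.
have intk i D : measurable D ->
    (\int[mu]_(t in D) (`|g i t| `^ alpha)%:E <= kappa%:E)%E.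
  by move=> mD; apply: le_trans (gk i); apply: ge0_subset_integral.
have int0 i D : (0 <= \int[mu]_(t in D) (`|g i t| `^ alpha)%:E)%E.
  by apply: integral_ge0 => t _; rewrite lee_fin powR_ge0.
have intfin i D : measurable D ->
    (\int[mu]_(t in D) (`|g i t| `^ alpha)%:E)%E \is a fin_num.
  by move=> mD; rewrite ge0_fin_numE// (le_lt_trans (intk i D mD)) ?ltry.
have mQC i : measurable (~` Q i) by exact: measurableC.
pose A i := atoms_sum M (sfun_atoms (g i) (Q i)).
pose B i := atoms_sum M (sfun_atoms (g i) (~` Q i)).
have mA i : measurable_fun setT (A i).
  rewrite /A; apply: (measurable_atoms_sum M_stable).
  by apply: (good_sfun_atoms (gfin i) (mQ i)).
have mB i : measurable_fun setT (B i).
  apply: (measurable_atoms_sum M_stable).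
  by apply: (good_sfun_atoms (gfin i) (mQC i)).
have law i D : measurable D ->
    stable_law P alpha (fine (\int[mu]_(t in D) (`|g i t| `^ alpha)%:E)%E)
      (atoms_sum M (sfun_atoms (g i) D)).
  move=> mD; rewrite integral_sfun_atoms//=.
  by apply: stable_law_atoms_sum => //; exact: good_sfun_atoms.
have AA i j : i != j -> indep_pair P (A i) (A j).
  move=> ij; apply: (indep_atoms_sum M_stable).
  apply: (good_sfun_atoms2 (alpha := alpha)) => //.
  by move/trivIsetP : tQ => /(_ i j Logic.I Logic.I ij).
have AB i : indep_pair P (A i) (B i).
  apply: (indep_atoms_sum M_stable).
  by apply: (good_sfun_atoms2 (alpha := alpha)) => //; rewrite setICr.
pose E i := [set w | K' < `|A i w|]; pose F i := [set w | 2 / u < `|B i w|].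
have mE i : measurable (E i) by exact: measurable_norm_gt.
have mF i : measurable (F i) by exact: measurable_norm_gt.
pose l := \sum_(i < n) fine (P (E i)).
have cSl : c * S / K' `^ alpha <= l.
  apply: (@le_trans _ _ (\sum_(i < n) c *
      (fine (\int[mu]_(t in Q i) (`|g i t| `^ alpha)%:E)%E / K' `^ alpha))).
    by rewrite -mulr_sumr -mulr_suml -mulrA ler_pM2l// ler_pM2r// invr_gt0.
  apply: ler_sum => i _; apply: lower => //; last exact: law.
    by rewrite fine_ge0.
  by apply: le_trans kK; rewrite -lee_fin fineK ?intfin//; exact: intk.
have cS0 : 0 < c * S / K' `^ alpha by rewrite divr_gt0// mulr_gt0.
have l0 : 0 < l by exact: lt_le_trans cSl.
have Fd i : fine (P (F i)) <= 2 * (kappa * u `^ alpha).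
  have := stable_tail_upper alpha_gt0 (mB i) (fine_ge0 (int0 i _)) u0 (law i _ (mQC i)).
  move=> /le_trans; apply; rewrite ler_pM2l// ler_wpM2r ?powR_ge0//.
  by rewrite -lee_fin fineK ?intfin//; exact: intk.
have := @second_moment_bound _ _ _ P n E F (2 * (kappa * u `^ alpha)) l mE mF
  (fun i j ij => indep_pair_norm_gt _ _ (AA i j ij))
  (fun i => indep_pair_norm_gt _ _ (AB i)) Fd erefl l0.
have bad : \bigcap_i [set w | `|A i w + B i w| <= K] `<=` \bigcap_i ~` (E i `\` F i).
  move=> w H i _ [Ei Fi]; have := H i Logic.I => /=.
  move: Ei Fi; rewrite /E /F /= => Ei /negP; rewrite -leNgt => Fi.
  have := ler_normB (A i w + B i w) (B i w); rewrite addrK /K' in Ei *; lra.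
have mbad : measurable (\bigcap_i [set w | `|A i w + B i w| <= K]).
  apply: fin_bigcap_measurable => [|i _]; first exact: finite_finset.
  by apply: measurable_norm_le; exact: measurable_funD.
have mgood : measurable (\bigcap_i ~` (E i `\` F i)).
  apply: fin_bigcap_measurable => [|i _]; first exact: finite_finset.
  by apply: measurableC; exact: measurableD.
have le1 : fine (P (\bigcap_i [set w | `|A i w + B i w| <= K])) <=
    fine (P (\bigcap_i ~` (E i `\` F i))).
  by apply: fine_le; rewrite ?fin_num_measure//; apply: le_measure; rewrite ?inE.
move=> /(le_trans le1) /le_trans; apply.
have : 4 / l <= 4 * K' `^ alpha / (c * S).
  have -> : 4 * K' `^ alpha / (c * S) = 4 / (c * S / K' `^ alpha).
    by field; rewrite !gt_eqF.
  by rewrite ler_pM2l// lef_pV2 ?posrE.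
move: (kappa * u `^ alpha) => x; lra.
Qed.

End small_probability.

(** A quasi-triangle inequality that covers alpha < 1 and alpha >= 1 alike: |a + b| is at most twice
    the larger of |a| and |b|. *)
Lemma powR_normD_le (R : realType) (alpha a b : R) : 0 < alpha ->
  `|a + b| `^ alpha <= 2 `^ alpha * (`|a| `^ alpha + `|b| `^ alpha).
Proof.
move=> al0.
wlog ab : a b / `|a| <= `|b|.
  move=> H; have [ab|/ltW ba] := leP `|a| `|b|; first exact: H.
  by rewrite addrC [X in _ * X]addrC; exact: H.
apply: (@le_trans _ _ ((2 * `|b|) `^ alpha)).
  apply: ge0_ler_powR; rewrite ?nnegrE ?(ltW al0) ?mulr_ge0//.
  by apply: (le_trans (ler_normD _ _)); rewrite mulr_natl mulr2n lerD2r.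
by rewrite powRM// ler_wpM2l ?powR_ge0// lerDr powR_ge0.
Qed.

Lemma cvg0_near_lt (R : realType) (u : nat -> \bar R) (e : R) : 0 < e ->
  u @ \oo --> 0%E -> \forall n \near \oo, (u n < e%:E)%E.
Proof.
move=> e0 u0; have : nbhs 0%E [set x : \bar R | (x < e%:E)%E].
  by apply: open_nbhs_nbhs; split; [exact: open_ereal_lt_ereal|rewrite /= lte_fin].
by move=> /u0.
Qed.

(** * From simple functions to general integrands *)

Section stable_integrals.
Context dO (Om : measurableType dO) (R : realType) (P : probability Om R).
Context dT (T : measurableType dT) (mu : {measure set T -> \bar R}).
Variables (alpha : R) (M : set T -> Om -> R).
Hypothesis alpha_gt0 : 0 < alpha.
Hypothesis M_stable : stable_random_measure P mu alpha M.

Lemma measurable_powR_norm (f : T -> R) D : measurable_fun setT f ->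
  measurable_fun D (fun t => (`|f t| `^ alpha)%:E).
Proof.
move=> mf; apply: (@measurable_funS _ _ _ _ setT) => //.
apply/measurable_EFinP; apply: (measurableT_comp (measurable_powR _)) => //.
exact: measurableT_comp.
Qed.

Lemma integral_powR_quasi (f g : T -> R) D : measurable D ->
  measurable_fun setT f -> measurable_fun setT g ->
  (\int[mu]_(t in D) (`|f t| `^ alpha)%:E <= (2 `^ alpha)%:E *
    (\int[mu]_(t in D) (`|f t - g t| `^ alpha)%:E +
     \int[mu]_(t in D) (`|g t| `^ alpha)%:E))%E.
Proof.
move=> mD mf mg.
have mfg : measurable_fun setT (fun t => f t - g t) by exact: measurable_funB.
rewrite -ge0_integralD//; try exact: measurable_powR_norm.
have ge0 t : (0 <= (`|f t - g t| `^ alpha)%:E + (`|g t| `^ alpha)%:E)%E.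
  by rewrite -EFinD lee_fin addr_ge0 ?powR_ge0.
rewrite -ge0_integralZl//; last first.
  by apply: emeasurable_funD; exact: measurable_powR_norm.
apply: ge0_le_integral => //.
- exact: measurable_powR_norm.
- by apply: measurable_funeM; apply: emeasurable_funD; exact: measurable_powR_norm.
- move=> t _; rewrite -EFinD -EFinM lee_fin -{1}(subrK (g t) (f t)).
  exact: powR_normD_le.
Qed.

Lemma stable_integral_approx (f : T -> R) (Z : Om -> R) (e : R) : 0 < e ->
  is_stable_integral P mu alpha M f Z ->
  exists g : {sfun T >-> R}, [/\ (Lpow mu alpha g < +oo)%E,
    (Lpow mu alpha (fun t => g t - f t)%R < e%:E)%E &
    (P [set w | (1 <= `|stable_sintegral M g w - Z w|)%R] < e%:E)%E].
Proof.
move=> e0 [mf ffin mZ [g [gfin gf gZ]]].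
have n1 := cvg0_near_lt e0 gf; have n2 := cvg0_near_lt e0 (gZ 1 ltr01).
have [n _ /(_ n (leqnn n)) [h1 h2]] := filterI n1 n2.
by exists (g n).
Qed.

(** S depends on n, K and e only, not on the number of integrands or the sets Q; the caller can
    therefore choose these after S. *)
Lemma stable_integrals_bound (n K e : R) : alpha < 2 -> 0 <= n -> 0 <= K -> 0 < e ->
  exists S : R, forall N (f : 'I_N -> T -> R) (Z : 'I_N -> Om -> R)
    (Q : 'I_N -> set T),
    (forall i, is_stable_integral P mu alpha M (f i) (Z i)) ->
    (forall i, (Lpow mu alpha (f i) <= n%:E)%E) ->
    (forall i, measurable (Q i)) -> trivIset setT Q ->
    (S%:E <= \sum_(i < N) \int[mu]_(t in Q i) (`|f i t| `^ alpha)%:E)%E ->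
    (P (\bigcap_(i : 'I_N) [set w | `|Z i w|%R <= K]%R) <= e%:E)%E.
Proof.
move=> alpha_lt2 n0 K0 e0.
have [c c0 lower] := stable_tail_lower P alpha_gt0 alpha_lt2.
pose a2 : R := 2 `^ alpha.
have a20 : 0 < a2 by rewrite powR_gt0.
(* Bounds the approximating simple functions, whose error will be at most 1. *)
pose kappa := a2 * (1 + n).
have k0 : 0 < kappa by rewrite mulr_gt0//; lra.
(* The first entry makes the tail term 4 kappa u^alpha at most e / 4, the second makes 2 / u at
   least kappa^(1 / alpha). *)
pose u := Num.min ((e / 16 / kappa) `^ alpha^-1) (2 / kappa `^ alpha^-1).
have u0 : 0 < u by rewrite lt_min !powR_gt0 ?divr_gt0// powR_gt0.
have ua : 4 * (kappa * u `^ alpha) <= e / 4.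
  have : u `^ alpha <= e / 16 / kappa.
    have -> : e / 16 / kappa = ((e / 16 / kappa) `^ alpha^-1) `^ alpha.
      by rewrite -powRrM mulVf ?gt_eqF// powRr1// !divr_ge0// ltW.
    apply: ge0_ler_powR; rewrite ?nnegrE ?(ltW u0) ?powR_ge0 ?(ltW alpha_gt0)//.
    by rewrite ge_min lexx.
  rewrite ler_pdivlMr// => h; lra.
have u20 : 0 < 2 / u by rewrite divr_gt0.
have kK : kappa <= (K + 1 + 2 / u) `^ alpha.
  have -> : kappa = (kappa `^ alpha^-1) `^ alpha.
    by rewrite -powRrM mulVf ?gt_eqF// powRr1// ltW.
  apply: ge0_ler_powR; rewrite ?nnegrE ?powR_ge0 ?(ltW alpha_gt0)//; first lra.
  have : kappa `^ alpha^-1 <= 2 / u.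
    have ka : 0 < kappa `^ alpha^-1 by rewrite powR_gt0.
    have : u <= 2 / kappa `^ alpha^-1 by rewrite ge_min lexx orbT.
    by rewrite !ler_pdivlMr// mulrC.
  lra.
(* The summand 1 absorbs the difference between Z i and its simple approximation. *)
set K' := K + 1 + 2 / u in kK.
have K'0 : 0 < K' by rewrite /K'; lra.
have K'a : 0 < K' `^ alpha by rewrite powR_gt0.
(* Makes 4 K'^alpha / (c S) equal to e / 4. *)
pose S := 16 * K' `^ alpha / (c * e).
have S0 : 0 < S by rewrite divr_gt0 ?mulr_gt0.
exists (a2 * (S + 1)) => N f Z Q Zf fn mQ tQ SQ.
(* Summed over N indices, the approximation errors stay below 1 and the exceptional probabilities
   below e / 4; [N.+1] avoids dividing by 0. *)
pose d := Num.min 1 (e / 4) / N.+1%:R.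
have d0 : 0 < d by rewrite divr_gt0// lt_min ltr01 divr_gt0.
have dN1 : d *+ N <= Num.min 1 (e / 4).
  rewrite -mulr_natr mulrAC ler_pdivrMr// ler_wpM2l ?ler_nat//.
  by rewrite le_min ler01 divr_ge0// ltW.
have d1 : d <= 1.
  rewrite ler_pdivrMr// mul1r ge_min; apply/orP; left; by rewrite ler1n.
have /choice[g gP] i := stable_integral_approx d0 (Zf i).
have mf i : measurable_fun setT (f i) by have [] := Zf i.
have mZ i : measurable_fun setT (Z i) by have [] := Zf i.
have mgs i : measurable_fun setT (stable_sintegral M (g i)).
  rewrite stable_sintegralE; apply: (measurable_atoms_sum M_stable).
  by have [gfin _ _] := gP i; apply: good_sfun_atoms gfin _.
have gk i : (Lpow mu alpha (g i) <= kappa%:E)%E.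
  have [_ gf _] := gP i.
  have := @integral_powR_quasi (g i) (f i) setT measurableT (measurable_funPT _) (mf i).
  move=> /le_trans; apply; rewrite /kappa EFinM lee_pmul2l//.
  rewrite EFinD leeD//; last exact: fn.
  by apply: (le_trans (ltW gf)); rewrite lee_fin.
(* Replacing f by g costs the factor 2^alpha and a total error of at most 1, hence the witness
   2^alpha (S + 1). *)
have gS : S <= \sum_(i < N) fine (\int[mu]_(t in Q i) (`|g i t| `^ alpha)%:E)%E.
  have gi i : (\int[mu]_(t in Q i) (`|g i t| `^ alpha)%:E <= kappa%:E)%E.
    apply: le_trans (gk i); apply: ge0_subset_integral => //.
    exact: measurable_powR_norm.
  have gfn i : (\int[mu]_(t in Q i) (`|g i t| `^ alpha)%:E)%E \is a fin_num.
    by rewrite ge0_fin_numE ?integral_ge0// (le_lt_trans (gi i)) ?ltry.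
  have : ((a2 * (S + 1))%:E <= \sum_(i < N) (a2%:E * (d%:E +
      \int[mu]_(t in Q i) (`|g i t| `^ alpha)%:E)))%E.
    apply: (le_trans SQ); apply: lee_sum => i _.
    have := @integral_powR_quasi (f i) (g i) (Q i) (mQ i) (mf i) (measurable_funPT _).
    move=> /le_trans; apply; rewrite lee_pmul2l// leeD2r//.
    have [_ gf _] := gP i; apply: le_trans (ltW gf).
    rewrite /Lpow; under eq_integral do rewrite distrC.
    apply: ge0_subset_integral => //; apply: measurable_powR_norm.
    exact: measurable_funB.
  rewrite -ge0_sume_distrr; last first.
    by move=> i _; rewrite adde_ge0// ?lee_fin ?(ltW d0)// integral_ge0.
  rewrite EFinM lee_pmul2l//.
  under eq_bigr do rewrite -(fineK (gfn _)) -EFinD.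
  rewrite sumEFin lee_fin big_split /= sumr_const card_ord => h.
  have : d *+ N <= 1 by apply: (le_trans dN1); rewrite ge_min lexx.
  lra.
have K10 : 0 <= K + 1 by lra.
have main := sfun_sums_bound alpha_gt0 M_stable c0 lower u0 K10 S0 kK mQ tQ gk gS.
set G := \bigcap_i _ in main.
pose D i := [set w | 1 <= `|stable_sintegral M (g i) w - Z i w|].
have mlt (X : Om -> R) r : measurable_fun setT X -> measurable [set w | r <= `|X w|].
  move=> mX; rewrite -[X in measurable X]setTI.
  have : measurable_fun setT (fun w => `|X w|) by exact: measurableT_comp.
  move=> /(_ measurableT `[r, +oo[%classic) /(_ (measurable_itv _)).
  by congr measurable; apply/seteqP; split => w /=; rewrite in_itv /= andbT.
have mD i : measurable (D i) by apply: mlt; exact: measurable_funB.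
have mG : measurable G.
  apply: fin_bigcap_measurable => [|i _]; first exact: finite_finset.
  apply: measurable_norm_le; apply: measurable_funD; apply: (measurable_atoms_sum M_stable).
    by have [gfin _ _] := gP i; apply: good_sfun_atoms gfin _.
  by have [gfin _ _] := gP i; apply: good_sfun_atoms gfin _; exact: measurableC.
have splitae : {ae P, forall w, forall i, stable_sintegral M (g i) w =
    atoms_sum M (sfun_atoms (g i) (Q i)) w + atoms_sum M (sfun_atoms (g i) (~` Q i)) w}.
  apply: filter_forall => i; have [gfin _ _] := gP i.
  exact: (sfun_atoms_split M_stable gfin (mQ i)).
have [N0 [mN0 PN0 subN0]] := splitae.
have mZK : measurable (\bigcap_(i : 'I_N) [set w | `|Z i w| <= K]).
  apply: fin_bigcap_measurable => [|i _]; first exact: finite_finset.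
  exact: measurable_norm_le.
pose DU := \big[setU/set0]_(i < N) D i.
have mDU : measurable DU by exact: bigsetU_measurable.
have sub : \bigcap_(i : 'I_N) [set w | `|Z i w| <= K] `<=` G `|` (DU `|` N0).
  move=> w ZK; have [wN|wN] := pselect (N0 w); first by right; right.
  have [wD|wD] := pselect (DU w); first by right; left.
  left => i _ /=.
  have wS : forall i, stable_sintegral M (g i) w =
    atoms_sum M (sfun_atoms (g i) (Q i)) w + atoms_sum M (sfun_atoms (g i) (~` Q i)) w.
    by apply: contrapT => /subN0.
  rewrite -wS.
  have : `|stable_sintegral M (g i) w - Z i w| < 1.
    rewrite ltNge; apply/negP => Di; apply: wD; rewrite /DU -bigcup_seq.
    by exists i => //=; rewrite mem_index_enum.
  have := ZK i Logic.I => /=.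
  have := ler_normD (stable_sintegral M (g i) w - Z i w) (Z i w); rewrite subrK; lra.
apply: (@le_trans _ _ (P (G `|` (DU `|` N0)))).
  by apply: le_measure; rewrite ?inE//; apply: measurableU => //; exact: measurableU.
have le2 : (P (G `|` (DU `|` N0)) <= P G + (P DU + P N0))%E.
  apply: (le_trans (measureU2 _ _ _)) => //; first exact: measurableU.
  by rewrite leeD2l// measureU2.
apply: (le_trans le2); rewrite PN0 adde0.
have PDU : (P DU <= (e / 4)%:E)%E.
  apply: (@le_trans _ _ (\sum_(i < N) P (D i))%E).
    rewrite /DU; elim: (index_enum _) => [|i r IH].
      by rewrite !big_nil measure0.
    rewrite !big_cons; apply: le_trans (leeD2l _ IH).
    by apply: measureU2 => //; exact: bigsetU_measurable.
  apply: (@le_trans _ _ (\sum_(i < N) d%:E)%E).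
    by apply: lee_sum => i _; have [_ _ /ltW] := gP i.
  rewrite sumEFin sumr_const card_ord lee_fin.
  by apply: (le_trans dN1); rewrite ge_min lexx orbT.
have PG : (P G <= (e / 4 + e / 4)%:E)%E.
  rewrite -(fineK (fin_num_measure P G mG)) lee_fin (le_trans main)//.
  apply: lerD => //; rewrite -/K' /S le_eqVlt; apply/orP; left; apply/eqP.
  by field; rewrite !gt_eqF.
apply: (le_trans (leeD PG PDU)); rewrite -EFinD lee_fin; lra.
Qed.

End stable_integrals.

(** * The moving average field *)

(** The trace is the sum of the d complex roots of the characteristic polynomial, each of real part
    above 1. *)
Lemma trace_gt_dim (R : realType) (d : nat) (E : 'M[R]_d) : (0 < d)%N ->
  (forall z : R[i], eigenvalue (map_mx (real_complex R) E) z -> 1 < complex.Re z) ->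
  d%:R < \tr E.
Proof.
move=> d0 spec; pose A := map_mx (real_complex R) E.
have [r rE] := closed_field_poly_normal (char_poly A).
rewrite (monicP (char_poly_monic A)) scale1r in rE.
have sr : size r = d.
  by have := size_char_poly A; rewrite rE size_prod_XsubC => -[].
have r0 : size r != 0%N by rewrite sr -lt0n.
have trE : \tr A = \sum_(z <- r) z.
  by apply: oppr_inj; rewrite -(coefPn_prod_XsubC r0) -rE sr char_poly_trace.
have -> : \tr E = \sum_(z <- r) complex.Re z.
  have -> : \tr E = complex.Re (\tr A) by rewrite /A trace_map_mx.
  by rewrite trE; elim: r {rE sr trE r0} => [|[a b] r IH]; rewrite ?big_nil// !big_cons -IH;
    case: (\sum_(z <- r) z).
have rspec : {in r, forall z, 1 < complex.Re z}.
  by move=> z zr; apply: spec; rewrite eigenvalue_root_char rE root_prod_XsubC.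
rewrite -sr; case: r r0 rspec {rE sr trE} => // z r _ rspec.
rewrite big_cons /= -natr1 addrC ltr_leD ?rspec ?mem_head//.
have {}rspec : {in r, forall z, 1 < complex.Re z}.
  by move=> x xr; apply: rspec; rewrite in_cons xr orbT.
elim: r rspec => [|x r IH] rspec; first by rewrite big_nil.
rewrite big_cons /= -natr1 addrC lerD ?(ltW (rspec x _)) ?mem_head//.
by apply: IH => y yr; apply: rspec; rewrite in_cons yr orbT.
Qed.

(** Were the claim false, the complements of the closures of F n [&] W would be open and dense, and
    a point of W in all of them would lie in no F n. Intersecting with W is needed because F n may
    be dense in regions away from W. *)
Lemma baire_somewhere_dense (R : realType) (U : completeNormedModType R)
  (W : set U) (F : nat -> set U) : open W -> W !=set0 -> W `<=` \bigcup_n F n ->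
  exists n V, [/\ open V, V !=set0, V `<=` W & V `<=` closure (F n)].
Proof.
move=> oW W0 WF; apply: contrapT => H.
have : dense (\bigcap_n ~` closure (F n `&` W)).
  apply: Baire => n; split; first by apply: closed_openC; exact: closed_closure.
  move=> V V0 oV; apply: contrapT => VF.
  have VC : V `<=` closure (F n `&` W).
    by move=> x Vx; apply: contrapT => nx; apply: VF; exists x.
  apply: H; exists n, (V `&` W); split.
  - exact: openI.
  - have [x Vx] := V0; have [y [[_ Wy] Vy]] := VC x Vx V (open_nbhs_nbhs (conj oV Vx)).
    by exists y.
  - by move=> x [].
  - by move=> x [/VC + _]; apply: closure_subset => y [].
move=> /(_ W W0 oW) [x [Wx Fx]].
have [n _ Fnx] := WF x Wx.
by apply: (Fx n Logic.I); apply: subset_closure.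
Qed.

(** * Baire, Lindelof and boxes in Euclidean space *)

Section column_vectors.
Variables (R : realType) (d : nat).

Lemma baire_cV (W : set 'cV[R]_d) (F : nat -> set 'cV[R]_d) :
  open W -> W !=set0 -> W `<=` \bigcup_n F n ->
  exists n (V : set 'cV[R]_d),
    [/\ open V, V !=set0, V `<=` W & V `<=` closure (F n)].
Proof.
(* The library declares matrices complete and normed, but not the join. *)
pose U : completeNormedModType R :=
  HB.pack_for (completeNormedModType R) 'cV[R]_d.
exact: (@baire_somewhere_dense R U W F).
Qed.

(** For each rational ball contained in some U x with x in F, pick one such x; the other balls, and
    codes of no ball, get points of F that do no harm. *)
Lemma lindelof_cV (F D : set 'cV[R]_d) (U : 'cV[R]_d -> set 'cV[R]_d) :
  F !=set0 -> (forall x, open (U x)) -> D `<=` \bigcup_(x in F) U x ->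
  exists x : nat -> 'cV[R]_d, (forall n, F (x n)) /\ D `<=` \bigcup_n U (x n).
Proof.
move=> [x0 Fx0] oU DU.
pose B (p : 'cV[rat]_d * nat) : set 'cV[R]_d :=
  ball (map_mx ratr p.1 : 'cV[R]_d) p.2.+1%:R^-1.
have /choice[h hP] (p : 'cV[rat]_d * nat) : exists x, F x /\
    ((exists2 x, F x & B p `<=` U x) -> B p `<=` U x).
  have [[x Fx Bx]|nx] := pselect (exists2 x, F x & B p `<=` U x).
    by exists x.
  by exists x0; split.
exists (fun n => if unpickle n is Some p then h p else x0); split.
  by move=> n; case: unpickle => // p; have [] := hP p.
move=> y /DU[x Fx]; rewrite (open_cV_rat_balls (oU x)) => -[p /= pU py].
exists (pickle p) => //; rewrite pickleK.
by have [_] := hP p; apply; [exists x|exact: py].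
Qed.

Definition box (a b : 'cV[R]_d) : set 'cV[R]_d :=
  [set x | forall i, a i 0 < x i 0 <= b i 0].

Lemma measurable_box (a b : 'cV[R]_d) : measurable (box a b : set (borel_cV R d)).
Proof.
have -> : box a b = \bigcap_(i : 'I_d)
    ((fun v : borel_cV R d => (v : 'cV[R]_d) i 0) @^-1` `]a i 0, b i 0]%classic).
  by apply/seteqP; split => x H i; have := H i; rewrite /= in_itv //=; apply.
apply: fin_bigcap_measurable => [|i _]; first exact: finite_finset.
by apply: measurable_preimage => //; exact: coord_cV_measurable.
Qed.

Lemma open_box (V : set 'cV[R]_d) (c : 'cV[R]_d) : open V -> V c ->
  exists a b, box a b `<=` V /\ exists2 m : R, 0 < m & lebesgue_cV R d (box a b) = m%:E.
Proof.
move=> oV Vc; have /nbhs_ballP[e /= e0 eV] : nbhs c V by exact: open_nbhs_nbhs.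
pose s : 'cV[R]_d := const_mx (e / 2).
exists (c - s), (c + s); split.
  move=> x H; apply: eV; split => // i j; rewrite (ord1 j) /ball /=.
  have := H i; rewrite !mxE => /andP[h1 h2].
  by rewrite ltr_norml; apply/andP; split; lra.
exists (\prod_(i < d) ((c + s) i 0 - (c - s) i 0)).
  by apply: prodr_gt0 => i _; rewrite !mxE; lra.
by apply: lebesgue_cV_box => i; rewrite !mxE; lra.
Qed.

End column_vectors.

Lemma powR_le_neg (R : realType) (g a b : R) : g < 0 -> 0 < a -> a <= b ->
  b `^ g <= a `^ g.
Proof.
move=> g0 a0 ab; have b0 : 0 < b by exact: lt_le_trans ab.
rewrite -(opprK g) !(powRN _ (- g)) lef_pV2 ?posrE ?powR_gt0//.
by apply: ge0_ler_powR; rewrite ?nnegrE ?(ltW a0) ?(ltW b0) ?oppr_ge0 ?(ltW g0).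
Qed.

Lemma operator_homogeneous0 (R : realType) (d : nat) (E : 'M[R]_d) phi :
  operator_homogeneous E phi -> phi 0 = 0.
Proof.
by move=> /(_ 2 0 (ltr0n _ 2)); rewrite mulmx0 => h; lra.
Qed.

Section translations.
Variables (R : realType) (W : normedModType R).

Lemma continuous_addl (y : W) : continuous (fun z => y + z).
Proof. by move=> z; apply: cvgD; [exact: cvg_cst|exact: cvg_id]. Qed.

Lemma continuous_subl (x : W) : continuous (fun y => x - y).
Proof. by move=> y; apply: cvgB; [exact: cvg_cst|exact: cvg_id]. Qed.

Lemma continuous_subr (y : W) : continuous (fun x => x - y).
Proof. by move=> x; apply: cvgB; [exact: cvg_id|exact: cvg_cst]. Qed.

Lemma continuous_neg : continuous (fun y : W => - y).
Proof. by move=> y; apply: cvgN; exact: cvg_id. Qed.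

End translations.

(** * The field at finitely many points of an open set *)

Section field_unbounded.
Variables (R : realType) (d : nat).
Local Notation cV := 'cV[R]_d.+1.
Variables (phi : cV -> R) (E : 'M[R]_d.+1) (alpha : R).
Hypothesis phi_ge0 : forall x, 0 <= phi x.
Hypothesis phi_continuous : continuous phi.
Hypothesis phi0 : phi 0 = 0.
Hypothesis phi_neq0 : forall x, x != 0 -> phi x != 0.
Hypothesis alpha_gt0 : 0 < alpha.
Hypothesis alpha_lt2 : alpha < 2.
Hypothesis alpha_lt_tr : alpha < \tr E.
Context dO (Om : measurableType dO) (P : probability Om R).
Variables (M : set cV -> Om -> R) (Z : cV -> Om -> R).
Hypothesis M_stable : stable_random_measure P (lebesgue_cV R d.+1) alpha M.
Hypothesis Z_integral : forall x : cV, is_stable_integral P (lebesgue_cV R d.+1)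
  alpha M (moving_average_kernel alpha E phi x) (Z x).

Local Notation kern := (moving_average_kernel alpha E phi).
Local Notation leb := (lebesgue_cV R d.+1).

Lemma phi_gt0 x : x != 0 -> 0 < phi x.
Proof. by move=> x0; rewrite lt_neqAle eq_sym phi_neq0//=. Qed.

Lemma nonzero_vector_small (G : set cV) : nbhs (0 : cV) G -> exists2 z, z != 0 & G z.
Proof.
move=> /nbhs_ballP[e /= e0 eG]; exists (const_mx (e / 2)).
  apply/eqP => /matrixP /(_ 0 0); rewrite !mxE; lra.
by apply: eG; split => // i j; rewrite /ball /= !mxE sub0r normrN gtr0_norm; lra.
Qed.

Lemma nbhs_translate (G : set cV) y : open G -> G y -> nbhs (0 : cV) [set z | G (y + z)].
Proof.
move=> oG Gy; have cy := @continuous_addl R cV y.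
have yG : nbhs (y + 0) G by rewrite addr0; exact: open_nbhs_nbhs.
exact: (cy 0 _ yG).
Qed.

Lemma open_phi_comp (h : cV -> cV) (A : set R) : continuous h -> open A ->
  open [set x | A (phi (h x))].
Proof.
move=> ch oA; apply: (@open_comp _ _ (fun x => phi (h x)) A) => // x _.
by apply: continuous_comp; [exact: ch|exact: phi_continuous].
Qed.

Lemma open_itvoo (p q : R) : open [set r : R | p < r < q].
Proof.
have -> : [set r : R | p < r < q] = `]p, q[%classic.
  by apply/seteqP; split => r /=; rewrite in_itv.
exact: interval_open.
Qed.

(** The exponent is negative because alpha < tr E, so both powers decrease in phi. *)
Lemma kernel_ge (m delta : R) x y : 0 < m -> m < phi (- y) ->
  0 < phi (x - y) < delta ->
  delta `^ (1 - \tr E / alpha) - m `^ (1 - \tr E / alpha) <= kern x y.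
Proof.
move=> m0 my /andP[xy0 xyd].
have g0 : 1 - \tr E / alpha < 0 by rewrite subr_lt0 ltr_pdivlMr// mul1r.
by apply: lerB; apply: powR_le_neg => //; exact: ltW.
Qed.

Lemma field_bounded_small (W : set cV) (K e : R) : open W -> W !=set0 ->
  0 <= K -> 0 < e ->
  exists N (x : 'I_N -> cV), (forall i, W (x i)) /\
    (P (\bigcap_(i : 'I_N) [set w | `|Z (x i) w|%R <= K]%R) <= e%:E)%E.
Proof.
move=> oW W0 K0 e0.
pose F (n : nat) := [set x | W x /\ (Lpow leb alpha (kern x) <= n%:R%:E)%E].
have WF : W `<=` \bigcup_n F n.
  move=> x Wx; have [_ ffin _ _] := Z_integral x.
  have l0 : (0 <= Lpow leb alpha (kern x))%E.
    by apply: integral_ge0 => t _; rewrite lee_fin powR_ge0.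
  exists (Num.bound (fine (Lpow leb alpha (kern x)))) => //; split => //.
  rewrite -[leLHS]fineK ?ge0_fin_numE// lee_fin ltW//.
  by apply: archi_boundP; rewrite fine_ge0.
have [n [G [oO [v Ov] OW OF]]] := baire_cV oW W0 WF.
(* Away from 0 the subtracted power of phi (- y) stays bounded, by m to the same power. *)
have [c Oc c0] : exists2 c, G c & c != 0.
  have [v0|] := eqVneq v 0; last by exists v.
  have [z z0] := nonzero_vector_small (nbhs_translate oO Ov).
  by rewrite v0 /= add0r => Oz; exists z.
pose m := phi (- c) / 2.
have pc : 0 < phi (- c) by apply: phi_gt0; rewrite oppr_eq0.
have m0 : 0 < m by rewrite divr_gt0.
pose G' := G `&` [set y | m < phi (- y)].
have oO' : open G'.
  apply: openI => //.
  exact: (@open_phi_comp (fun y => - y) [set r | m < r] (@continuous_neg R cV) (@open_gt R m)).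
have G'c : G' c by split => //=; rewrite /m; lra.
have [a [b [DO' [mu0 mu00 muD]]]] := open_box oO' G'c.
set D := box a b in DO' muD.
have mD : measurable (D : set (borel_cV R d.+1)) by exact: measurable_box.
have [S SP] := stable_integrals_bound alpha_gt0 M_stable alpha_lt2 (ler0n R n) K0 e0.
pose g := 1 - \tr E / alpha.
have g0 : g < 0 by rewrite subr_lt0 ltr_pdivlMr// mul1r.
(* A kernel of size L on half the volume of the box already yields S. *)
pose L := (2 * `|S| / mu0) `^ alpha^-1.
have L0 : 0 <= L by exact: powR_ge0.
have LS : L `^ alpha * (mu0 / 2) = `|S|.
  rewrite -powRrM mulVf ?gt_eqF// powRr1 ?divr_ge0 ?mulr_ge0 ?(ltW mu00)//.
  by field; rewrite gt_eqF.
(* Solves delta^g - m^g = L, the lower bound in [kernel_ge]. *)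
pose delta := (L + m `^ g) `^ g^-1.
have Lm : 0 < L + m `^ g by rewrite ltr_wpDl// powR_gt0.
have delta0 : 0 < delta by exact: powR_gt0.
have deltaE : delta `^ g - m `^ g = L.
  by rewrite -powRrM mulVf ?lt_eqF// powRr1 ?addrK// ltW.
(* Strict positivity excludes y = x, where [powR] returns 0 instead of a large value. *)
pose U x := [set y | 0 < phi (x - y) < delta].
have F0 : F n !=set0.
  by have [y [Fy _]] := OF v Ov G (open_nbhs_nbhs (conj oO Ov)); exists y.
have DU : D `<=` \bigcup_(x in F n) U x.
  move=> y /DO'[Oy my].
  have n1 := nbhs_translate oO Oy.
  have oG := open_phi_comp (@continuous_subr R cV y) (@open_lt R delta).
  have Gy : [set x | phi (x - y) < delta] y by rewrite /= subrr phi0.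
  have n2 := nbhs_translate oG Gy.
  (* Moving off y by a small nonzero z makes phi positive; the condition on x is open, so density of
     F n then supplies x near y + z. *)
  have [z z0 [Oyz /= yzd]] := nonzero_vector_small (filterI n1 n2).
  have oO2 : open (G `&` [set x | 0 < phi (x - y) < delta]).
    by apply: openI => //;
      exact: (open_phi_comp (@continuous_subr R cV y) (@open_itvoo 0 delta)).
  have O2yz : (G `&` [set x | 0 < phi (x - y) < delta]) (y + z).
    by split => //=; rewrite yzd andbT addrC addKr phi_gt0.
  have [x [Fx [_ Ux]]] := OF _ Oyz _ (open_nbhs_nbhs (conj oO2 O2yz)).
  by exists x.
have oU x : open (U x).
  exact: (open_phi_comp (@continuous_subl R cV x) (@open_itvoo 0 delta)).
have [x [Fx DUx]] := lindelof_cV F0 oU DU.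
pose A k := D `&` U (x k).
have mA k : measurable (A k : set (borel_cV R d.+1)).
  by apply: measurableI => //; exact: open_cV_measurable.
have AD : \bigcup_k A k = D.
  by rewrite -setI_bigcupr; apply/setIidPl.
pose Q := seqDU A.
have mQ k : measurable (Q k : set (borel_cV R d.+1)) by exact: seqDU_measurable.
have tQ : trivIset setT Q by exact: trivIset_seqDU.
have QA k : Q k `<=` A k by exact: subset_seqDU.
have QD : \bigcup_k Q k = D by rewrite -AD -seqDU_bigcup_eq.
have sQ : (fun N => (\sum_(0 <= k < N) leb (Q k))%E) @ \oo --> mu0%:E.
  rewrite -muD -QD; apply: measure_semi_sigma_additive => //.
  by rewrite QD.
(* Countable additivity lets finitely many of the sets Q fill half the box. *)
have [N muN] : exists N, ((mu0 / 2)%:E < \sum_(0 <= k < N) leb (Q k))%E.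
  have : nbhs mu0%:E [set r : \bar R | ((mu0 / 2)%:E < r)%E].
    apply: open_nbhs_nbhs; split; first exact: open_ereal_gt_ereal.
    by rewrite /= lte_fin; lra.
  by move=> /sQ[N _ /(_ N (leqnn N))]; exists N.
exists N, (fun i => x i); split; first by move=> i; have [] := Fx i.
apply: (SP N (fun i => kern (x i)) (fun i => Z (x i)) (fun i => Q i)) => //.
- by move=> i; have [] := Fx i.
- by move=> i j _ _ QQ; apply: val_inj; exact: (tQ (val i) (val j)).
apply: (@le_trans _ _ (\sum_(i < N) ((L `^ alpha)%:E * leb (Q i)))%E).
  rewrite -ge0_sume_distrr; last by move=> i _; exact: measure_ge0.
  apply: (@le_trans _ _ ((L `^ alpha)%:E * (mu0 / 2)%:E)%E).
    by rewrite -EFinM LS lee_fin ler_norm.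
  rewrite big_mkord in muN.
  by apply: lee_wpmul2l; [rewrite lee_fin powR_ge0|exact: ltW].
apply: lee_sum => i _.
have [mf _ _ _] := Z_integral (x i).
have -> : leb (Q i) = (\int[leb]_(t in Q i) cst 1 t)%E by rewrite integral_cst// mul1e.
rewrite -ge0_integralZl//; last by rewrite lee_fin powR_ge0.
apply: ge0_le_integral => //.
- by move=> t _; rewrite mule1 lee_fin powR_ge0.
- exact: measurable_powR_norm.
- move=> t /QA[Dt Ut]; rewrite mule1 lee_fin.
  apply: ge0_ler_powR; rewrite ?nnegrE ?(ltW alpha_gt0)//.
  have [_ mt] := DO' t Dt.
  by apply: le_trans (ler_norm _); rewrite -deltaE; exact: kernel_ge.
Qed.

End field_unbounded.

(** The balls of the library are for the maximum norm. Radius r / (d + 1) suffices since d < (d +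
    1)^2, also when d = 0. *)
Lemma ball_sub_eball (R : realType) (d : nat) (c : 'cV[R]_d) (r : R) : 0 < r ->
  exists2 e : R, 0 < e & ball c e `<=` eball c r.
Proof.
move=> r0; exists (r / d.+1%:R) => [|x]; first exact: divr_gt0.
rewrite /eball /enorm /= => -[_ cx].
have -> : r = Num.sqrt (r ^+ 2) by rewrite sqrtr_sqr gtr0_norm.
rewrite ltr_sqrt ?exprn_gt0//.
apply: (@le_lt_trans _ _ (\sum_(i < d) (r / d.+1%:R) ^+ 2)).
  apply: ler_sum => i _; rewrite -real_normK ?num_real// ler_sqr ?nnegrE//; last first.
    by rewrite divr_ge0// ltW.
  by have := cx i 0; rewrite /ball /= !mxE distrC => /ltW.
rewrite sumr_const card_ord -[_ *+ d]mulr_natl expr_div_n mulrCA gtr_pMr ?exprn_gt0//.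
rewrite ltr_pdivrMr ?exprn_gt0// mul1r -natrX ltr_nat.
by rewrite expnS expn1; apply: leq_pmulr.
Qed.

(** Stated for sets A not assumed measurable, as boundedness involves uncountably many points. *)
Lemma negligible_small d (T : measurableType d) (R : realType)
  (P : probability T R) (A : set T) :
  (forall e : R, 0 < e ->
    exists B, [/\ measurable B, A `<=` B & (P B <= e%:E)%E]) ->
  P.-negligible A.
Proof.
move=> H.
have /choice[B BP] (n : nat) : exists B,
    [/\ measurable B, A `<=` B & (P B <= n.+1%:R^-1%:E)%E] by apply: H; rewrite invr_gt0.
have mB : measurable (\bigcap_n B n).
  by apply: bigcap_measurable => // n _; have [] := BP n.
exists (\bigcap_n B n); split => //; last first.
  by move=> w Aw n _; have [_ + _] := BP n; apply.
apply/eqP; rewrite eq_le measure_ge0 andbT.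
apply/lee_addgt0Pr => e e0; rewrite add0e.
have [n ne] : exists n, n.+1%:R^-1 < e.
  by have /ltr_add_invr[n] := e0; rewrite add0r; exists n.
have [mBn _ PBn] := BP n.
apply: (@le_trans _ _ (P (B n))); last by rewrite (le_trans PBn)// lee_fin ltW.
by apply: le_measure; rewrite ?inE//; exact: bigcap_inf.
Qed.

Theorem proposition6p1 (R : realType) (d : nat) (d_ge2 : (2 <= d)%N)
    (E : 'M[R]_d)
    (E_spectrum : forall z : R[i],
      eigenvalue (map_mx (real_complex R) E) z -> 1 < complex.Re z)
    (normE : 'cV[R]_d -> R) (normE_norm : is_norm normE)
    (normE_polar : homeomorphism_on
      [set p : R * 'cV[R]_d | 0 < p.1 /\ normE p.2 = 1]
      [set x : 'cV[R]_d | x != 0] (polar_map E))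
    (phi : 'cV[R]_d -> R) (phi_ge0 : forall x, 0 <= phi x)
    (phi_continuous : continuous phi)
    (phi_homogeneous : operator_homogeneous E phi)
    (beta : R) (beta_gt1 : 1 < beta)
    (phi_admissible : admissible beta E normE phi)
    (alpha : R) (alpha_gt0 : 0 < alpha) (alpha_lt2 : alpha < 2)
    (dO : measure_display) (Om : measurableType dO) (P : probability Om R)
    (M : set 'cV[R]_d -> Om -> R)
    (M_stable : stable_random_measure P (lebesgue_cV R d) alpha M)
    (Z : 'cV[R]_d -> Om -> R)
    (Z_integral : forall x : 'cV[R]_d,
      is_stable_integral P (lebesgue_cV R d) alpha M
        (moving_average_kernel alpha E phi x) (Z x)) :
  {ae P, forall w, forall (c : 'cV[R]_d) (r : R), 0 < r ->
    ~ [bounded Z x w | x in eball c r]}.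
Proof.
case: d d_ge2 E E_spectrum normE normE_norm normE_polar phi phi_ge0 phi_continuous
  phi_homogeneous phi_admissible M M_stable Z Z_integral => // d d_ge2 E E_spectrum
  normE _ _ phi phi_ge0 phi_continuous phi_homogeneous [phi_neq0 _] M M_stable
  Z Z_integral.
have alpha_lt_tr : alpha < \tr E.
  apply: lt_trans (trace_gt_dim (ltn0Sn d) E_spectrum).
  by apply: (lt_le_trans alpha_lt2); rewrite ler_nat.
have phi0 := operator_homogeneous0 phi_homogeneous.
pose B (p : 'cV[rat]_d.+1 * nat) : set 'cV[R]_d.+1 :=
  ball (map_mx ratr p.1 : 'cV[R]_d.+1) p.2.+1%:R^-1.
have neg (p : 'cV[rat]_d.+1 * nat) (K : nat) :
    {ae P, forall w, ~ (forall x, B p x -> `|Z x w| <= K%:R)}.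
  apply: negligible_small => e e0.
  have B0 : B p !=set0.
    by exists (map_mx ratr p.1); apply: ballxx; rewrite invr_gt0.
  have oB : open (B p) by exact: ball_open.
  have [N [x [Bx Px]]] := field_bounded_small phi_ge0 phi_continuous phi0 phi_neq0
    alpha_gt0 alpha_lt2 alpha_lt_tr M_stable Z_integral oB B0 (ler0n R K) e0.
  exists (\bigcap_(i : 'I_N) [set w | `|Z (x i) w| <= K%:R]); split => //.
    apply: fin_bigcap_measurable => [|i _]; first exact: finite_finset.
    by have [_ _ mZ _] := Z_integral (x i); exact: measurable_norm_le.
  by move=> w /contrapT H i _; exact/H/Bx.
(* Pairs of a rational ball and an integer bound are enumerated by [pickle], so one null set serves
   all of them. *)
have negall : {ae P, forall w, forall n : nat,
    if unpickle n is Some (p, K) then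
      ~ (forall x, B p x -> `|Z x w| <= (K : nat)%:R) else True}.
  apply: ae_foralln => n; case: unpickle => [[p K]|]; last exact: aeW.
  exact: neg.
apply: filterS negall => w H c r r0 [L [_ HL]].
have [e e0 ce] := ball_sub_eball c r0.
have := open_cV_rat_balls (ball_open c e); move/seteqP => -[+ _].
move=> /(_ c (ballxx _ e0)) [p /= pc _].
have := H (pickle (p, Num.bound `|L|)); rewrite pickleK; apply => x Bx.
have Lb : L < (Num.bound `|L|)%:R :> R.
  by apply: le_lt_trans (ler_norm _) _; exact: archi_boundP.
exact: (HL _ Lb x (ce _ (pc _ Bx))).
Qed.
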